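(* Let $X,Y$ be real nonzero Banach spaces, $T:Y\rightrightarrows Y^*$ a maximal monotone operator of Gossez type (D) with strong representative function $h_T$, and $A:X\to Y$ linear continuous with $\operatorname{pr}_Y(\operatorname{dom}h_T)\cap\operatorname{im}A\neq\emptyset$. Then (a) ${}^{ic}(D(T)-\operatorname{im}A)=\operatorname{ri}(D(T)-\operatorname{im}A)={}^{ic}(\operatorname{co}D(T)-\operatorname{im}A)=\operatorname{ri}(\operatorname{co}D(T)-\operatorname{im}A)={}^{ic}(\operatorname{pr}_Y(\operatorname{dom}h_T)-\operatorname{im}A)=\operatorname{ri}(\operatorname{pr}_Y(\operatorname{dom}h_T)-\operatorname{im}A)$; (b) consequently the conditions $0\in{}^{ic}(D(T)-\operatorname{im}A)$, $0\in\operatorname{ri}(D(T)-\operatorname{im}A)$, $0\in{}^{ic}(\operatorname{co}D(T)-\operatorname{im}A)$, $0\in\operatorname{ri}(\operatorname{co}D(T)-\operatorname{im}A)$, $0\in{}^{ic}(\operatorname{pr}_Y(\operatorname{dom}h_T)-\operatorname{im}A)$, $0\in\operatorname{ri}(\operatorname{pr}_Y(\operatorname{dom}h_T)-\operatorname{im}A)$ are equivalent, and each implies that $A^*TA$ is maximal monotone of Gossez type (D).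
   Context: Spaces identified with their images in their biduals. $D(T)$ is the domain of $T$; $\operatorname{co}$ convex hull; $\operatorname{im}A=A(X)$; $A^*TA(x)=A^*(T(Ax))$. Coupling $c(y,y^* )=\langle y^*,y\rangle$. Conjugate of $h$ on $Y\times Y^*$: $h^*(y^*,y^{**})=\sup_{(y,z^* )}\{\langle y^*,y\rangle+\langle y^{**},z^*\rangle-h(y,z^* )\}$. Representative function of monotone $T$: convex norm-lsc $h_T$ with $h_T\ge c$ and $G(T)\subseteq\{h_T=c\}$; strong if $h_T^*(y^*,y^{**})\ge\langle y^{**},y^*\rangle$ for all. Gossez's closure $\overline T:Y^{**}\rightrightarrows Y^*$ has graph $\{(y^{**},y^* ):\langle y^{**}-z,y^*-z^*\rangle\ge0\ \forall(z,z^* )\in G(T)\}$; maximal monotone $T$ is of Gossez type (D) if each point of $G(\overline T)$ is the $w^*\times\|\cdot\|_*$-limit of a bounded net in $G(T)$. $\operatorname{icr}D=\{u:\forall x\in\operatorname{aff}(D-D)\ \exists\delta>0\ \forall\lambda\in[0,\delta]:u+\lambda x\in D\}$; ${}^{ic}D=\operatorname{icr}D$ if $\operatorname{aff}D$ closed, else $\emptyset$; $\operatorname{ri}D$ = interior relative to $\operatorname{aff}D$ if closed, else $\emptyset$. *)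

(* Defs.v *)
From Stdlib Require Import Reals.
Open Scope R_scope.

Record BanachSpace := {
  bcar :> Type;
  bzero : bcar;
  badd : bcar -> bcar -> bcar;
  bopp : bcar -> bcar;
  bscal : R -> bcar -> bcar;
  bnorm : bcar -> R;
  badd_assoc : forall x y z, badd x (badd y z) = badd (badd x y) z;
  badd_comm : forall x y, badd x y = badd y x;
  badd_0 : forall x, badd x bzero = x;
  badd_opp : forall x, badd x (bopp x) = bzero;
  bscal_assoc : forall a b x, bscal a (bscal b x) = bscal (a * b) x;
  bscal_1 : forall x, bscal 1 x = x;
  bscal_addr : forall a x y, bscal a (badd x y) = badd (bscal a x) (bscal a y);
  bscal_addl : forall a b x, bscal (a + b) x = badd (bscal a x) (bscal b x);
  bnorm_eq0 : forall x, bnorm x = 0 -> x = bzero;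
  bnorm_scal : forall a x, bnorm (bscal a x) = Rabs a * bnorm x;
  bnorm_triangle : forall x y, bnorm (badd x y) <= bnorm x + bnorm y;
  bcomplete : forall u : nat -> bcar,
    (forall eps, 0 < eps -> exists N, forall m n, (N <= m)%nat -> (N <= n)%nat ->
        bnorm (badd (u m) (bopp (u n))) < eps) ->
    exists l, forall eps, 0 < eps -> exists N, forall n, (N <= n)%nat ->
        bnorm (badd (u n) (bopp l)) < eps
}.

Arguments bzero {_}.
Arguments badd {_} _ _.
Arguments bopp {_} _.
Arguments bscal {_} _ _.
Arguments bnorm {_} _.

Definition bsub {E : BanachSpace} (x y : E) : E := badd x (bopp y).

Definition nonzero_space (E : BanachSpace) : Prop := exists x : E, x <> bzero.

Definition is_dual {E : BanachSpace} (f : E -> R) : Prop :=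
  (forall x y, f (badd x y) = f x + f y) /\
  (forall t x, f (bscal t x) = t * f x) /\
  (exists M, forall x, Rabs (f x) <= M * bnorm x).

Definition dual_bound {E : BanachSpace} (r : R) (f : E -> R) : Prop :=
  0 <= r /\ forall x, Rabs (f x) <= r * bnorm x.

Definition is_bidual {E : BanachSpace} (phi : (E -> R) -> R) : Prop :=
  (forall f g, is_dual f -> is_dual g -> phi (fun u => f u + g u) = phi f + phi g) /\
  (forall t f, is_dual f -> phi (fun u => t * f u) = t * phi f) /\
  (exists M, forall f r, is_dual f -> dual_bound r f -> Rabs (phi f) <= M * r).

Definition Op (E : BanachSpace) := E -> (E -> R) -> Prop.

Definition monotone {E : BanachSpace} (T : Op E) : Prop :=
  (forall y f, T y f -> is_dual f) /\
  (forall y f z g, T y f -> T z g -> 0 <= f (bsub y z) - g (bsub y z)).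

Definition maximal_monotone {E : BanachSpace} (T : Op E) : Prop :=
  monotone T /\
  forall y f, is_dual f ->
    (forall z g, T z g -> 0 <= f (bsub y z) - g (bsub y z)) -> T y f.

Definition gossez_closure {E : BanachSpace} (T : Op E) (phi : (E -> R) -> R)
  (f : E -> R) : Prop :=
  is_bidual phi /\ is_dual f /\
  forall z g, T z g -> 0 <= phi (fun u => f u - g u) - (f z - g z).

Definition gossez_typeD {E : BanachSpace} (T : Op E) : Prop :=
  maximal_monotone T /\
  forall phi f, gossez_closure T phi f ->
    exists (I : Type) (le : I -> I -> Prop) (yn : I -> E) (fn : I -> E -> R),
      inhabited I /\
      (forall i, le i i) /\
      (forall i j k, le i j -> le j k -> le i k) /\
      (forall i j, exists k, le i k /\ le j k) /\
      (forall i, T (yn i) (fn i)) /\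
      (exists M, forall i, bnorm (yn i) <= M /\ dual_bound M (fn i)) /\
      (forall g, is_dual g -> forall eps, 0 < eps ->
          exists i0, forall i, le i0 i -> Rabs (g (yn i) - phi g) < eps) /\
      (forall eps, 0 < eps ->
          exists i0, forall i, le i0 i -> dual_bound eps (fun u => fn i u - f u)).

Inductive xR := Fin (r : R) | PInf.

Definition xlt (a : R) (v : xR) : Prop :=
  match v with Fin r => a < r | PInf => True end.

Definition xle (a : R) (v : xR) : Prop :=
  match v with Fin r => a <= r | PInf => True end.

Definition EFun (E : BanachSpace) := E -> (E -> R) -> xR.

Definition convex_fun {E : BanachSpace} (h : EFun E) : Prop :=
  forall y1 f1 y2 f2 r1 r2 t, is_dual f1 -> is_dual f2 ->
    h y1 f1 = Fin r1 -> h y2 f2 = Fin r2 -> 0 <= t <= 1 ->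
    exists r, h (badd (bscal t y1) (bscal (1 - t) y2))
                (fun u => t * f1 u + (1 - t) * f2 u) = Fin r /\
              r <= t * r1 + (1 - t) * r2.

Definition norm_lsc {E : BanachSpace} (h : EFun E) : Prop :=
  forall y f a, is_dual f -> xlt a (h y f) ->
    exists delta, 0 < delta /\
      forall z g, is_dual g -> bnorm (bsub z y) < delta ->
        (exists d, d < delta /\ dual_bound d (fun u => g u - f u)) ->
        xlt a (h z g).

Definition representative {E : BanachSpace} (h : EFun E) (T : Op E) : Prop :=
  convex_fun h /\ norm_lsc h /\
  (forall y f, is_dual f -> xle (f y) (h y f)) /\
  (forall y f, T y f -> h y f = Fin (f y)).

(* strong: conj h (ys, yss) >= <yss, ys> for all (ys, yss) in E^* x E^**, where
   conj h (ys, yss) = sup over (y, zs) of ys(y) + yss(zs) - h(y, zs);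
   written out as the unfolded sup inequality. *)
Definition strong_rep {E : BanachSpace} (h : EFun E) : Prop :=
  forall f phi, is_dual f -> is_bidual phi ->
    forall b, b < phi f ->
      exists y g r, is_dual g /\ h y g = Fin r /\ b < f y + phi g - r.

Definition set (E : BanachSpace) := E -> Prop.

Definition dom_op {E : BanachSpace} (T : Op E) : set E := fun y => exists f, T y f.

Definition prY_dom {E : BanachSpace} (h : EFun E) : set E :=
  fun y => exists f, is_dual f /\ h y f <> PInf.

Definition image {X Y : BanachSpace} (A : X -> Y) : set Y := fun y => exists x, y = A x.

Definition set_minus {E : BanachSpace} (S U : set E) : set E :=
  fun y => exists a b, S a /\ U b /\ y = bsub a b.

Definition convex_set {E : BanachSpace} (C : set E) : Prop :=
  forall x y t, C x -> C y -> 0 <= t <= 1 ->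
    C (badd (bscal t x) (bscal (1 - t) y)).

Definition affine_set {E : BanachSpace} (C : set E) : Prop :=
  forall x y t, C x -> C y -> C (badd (bscal t x) (bscal (1 - t) y)).

Definition co {E : BanachSpace} (S : set E) : set E :=
  fun y => forall C, convex_set C -> (forall x, S x -> C x) -> C y.

Definition aff {E : BanachSpace} (S : set E) : set E :=
  fun y => forall C, affine_set C -> (forall x, S x -> C x) -> C y.

Definition closed_set {E : BanachSpace} (S : set E) : Prop :=
  forall y, (forall eps, 0 < eps -> exists z, S z /\ bnorm (bsub z y) < eps) -> S y.

Definition icr {E : BanachSpace} (D : set E) : set E :=
  fun u => forall x, aff (set_minus D D) x ->
    exists delta, 0 < delta /\
      forall lam, 0 <= lam <= delta -> D (badd u (bscal lam x)).

Definition ic {E : BanachSpace} (D : set E) : set E :=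
  fun u => closed_set (aff D) /\ icr D u.

Definition ri {E : BanachSpace} (D : set E) : set E :=
  fun u => closed_set (aff D) /\ D u /\
    exists eps, 0 < eps /\ forall v, aff D v -> bnorm (bsub v u) < eps -> D v.

Definition lin_cont {X Y : BanachSpace} (A : X -> Y) : Prop :=
  (forall x y, A (badd x y) = badd (A x) (A y)) /\
  (forall t x, A (bscal t x) = bscal t (A x)) /\
  (exists M, forall x, bnorm (A x) <= M * bnorm x).

Definition adj_comp {X Y : BanachSpace} (A : X -> Y) (T : Op Y) : Op X :=
  fun x g => exists f, T (A x) f /\ forall u, g u = f (A u).

(* Main.v *)
From Stdlib Require Import Reals Lra Lia List Classical ClassicalEpsilon FunctionalExtensionality ProofIrrelevance.
From mathcomp Require classical_sets.
Require Import Defs.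
Open Scope R_scope.

(* Write c for the coupling. The constraint qualification at u makes pr_Y (dom h) - im A contain a
   relative ball around u on which h, f and x stay bounded (Baire and Robinson's convex open
   mapping argument), so Fenchel duality is exact for x |-> A x + u: for a point (x0, g), the
   infimum over (x, f) of h (A x + u, f) - c + c ((x, A^* f) - (x0, g)) + p (x - x0)^2 / 2
   + p_* (A^* f - g)^2 / 2 is 0 for every equivalent norm p on X. Almost minimizers have h close
   to c; iterating from them converges to points of the graph of A^* T (A + u). This gives
   maximality and, in particular, a nonempty domain, i.e. u in D(T) - im A, which yields (a)
   because the closed affine hulls of all the sets coincide.

   For type (D), let (phi, g) be in the closure of A^* T A, let f_1, ..., f_n be functionals on X,
   and take x0 with f_j x0 = phi f_j and |x0| <= |phi| + 1 (Helly). Use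
   p = lam (|.| + N sum_j |f_j|): on phi - x0, which kills the f_j, the bidual of p does not see
   N. So almost minimizers satisfy |x - x0| + N sum_j |f_j (x - x0)| <= const with a constant
   independent of n, N and lam, while the dual component tends to g as lam -> 0. *)

(** * Vector identities and norms *)

(** The estimates control the pullbacks [A^* f] only; the functionals [f] on [Y] need not converge.
    So a limit point cannot be placed in the graph by closedness of [T]: its membership comes from a
    second duality argument, which produces a fresh [f0] in [T (A x0 + b)] with [s = A^* f0]. For
    the same reason the estimates run on triples [(x, f, d)], with [d] the excess of [h] over the
    coupling, and not on a representative function of [A^* T A], whose values would be infima over
    all [f] with a given pullback. The dual problem lives in [Y^* x X^**], since the penalty on
    [A^* f - g] is perturbed inside [X^*]; this is why strength of [h], an inequality on
    [Y^* x Y^**], makes the infimum vanish. The cross term [c] satisfies [|c| <= P Q] for bounds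
    [P], [Q] of the two penalized norms, so [d + c + P^2/2 + Q^2/2] is at least [d + (P - Q)^2/2]: a
    small value forces a small gap. *)

Inductive vexp :=
| VZero | VVar (n : nat) | VAdd (a b : vexp) | VOpp (a : vexp) | VScal (r : R) (a : vexp).

Fixpoint vden {E : BanachSpace} (env : list E) (e : vexp) : E :=
  match e with
  | VZero => bzero
  | VVar n => nth n env bzero
  | VAdd a b => badd (vden env a) (vden env b)
  | VOpp a => bopp (vden env a)
  | VScal r a => bscal r (vden env a)
  end.

Fixpoint vcoef (e : vexp) (n : nat) : R :=
  match e with
  | VZero => 0
  | VVar m => if Nat.eqb n m then 1 else 0
  | VAdd a b => vcoef a n + vcoef b n
  | VOpp a => - vcoef a n
  | VScal r a => r * vcoef a n
  end.

Fixpoint lincomb {E : BanachSpace} (env : list E) (c : nat -> R) : E :=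
  match env with
  | nil => bzero
  | v :: l => badd (bscal (c O) v) (lincomb l (fun n => c (S n)))
  end.

(** By recursion on [env] this unfolds to one real equation per atom, which [ring] or [field] can
    close; equality of coefficient functions at all indices would not reduce to finitely many
    goals. *)
Fixpoint coef_agree {E : BanachSpace} (env : list E) (c c' : nat -> R) : Prop :=
  match env with
  | nil => True
  | _ :: l => c O = c' O /\ coef_agree l (fun n => c (S n)) (fun n => c' (S n))
  end.

Section VectorIdentities.
Context {E : BanachSpace}.
Implicit Types (x y z : E) (env : list E).

Lemma badd_cancel x y z : badd x z = badd y z -> x = y.
Proof.
  intros H. rewrite <- (badd_0 _ x), <- (badd_0 _ y), <- (badd_opp _ z).
  now rewrite !badd_assoc, H.
Qed.

Lemma bscal_0l x : bscal 0 x = bzero.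
Proof.
  apply (badd_cancel _ _ (bscal 0 x)).
  rewrite <- bscal_addl, (badd_comm _ bzero), badd_0. f_equal. lra.
Qed.

Lemma bscal_0r (t : R) : bscal t (@bzero E) = bzero.
Proof. rewrite <- (bscal_0l bzero), bscal_assoc. f_equal. lra. Qed.

Lemma bopp_scal x : bopp x = bscal (-1) x.
Proof.
  apply (badd_cancel _ _ x). rewrite (badd_comm _ (bopp x)), badd_opp.
  rewrite <- (bscal_1 _ x) at 2. rewrite <- bscal_addl.
  replace (-1 + 1) with 0 by lra. now rewrite bscal_0l.
Qed.

Lemma badd_swap (x y z w : E) : badd (badd x y) (badd z w) = badd (badd x z) (badd y w).
Proof.
  rewrite <- !badd_assoc. f_equal. rewrite !badd_assoc. f_equal. apply badd_comm.
Qed.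

Lemma lincomb_add env c d : lincomb env (fun n => c n + d n) = badd (lincomb env c) (lincomb env d).
Proof.
  revert c d. induction env as [|v l IH]; intros c d; simpl; [now rewrite badd_0|].
  rewrite (IH (fun n => c (S n)) (fun n => d (S n))), bscal_addl. apply badd_swap.
Qed.

Lemma lincomb_scal env t c : lincomb env (fun n => t * c n) = bscal t (lincomb env c).
Proof.
  revert c. induction env as [|v l IH]; intros c; simpl; [now rewrite bscal_0r|].
  now rewrite (IH (fun n => c (S n))), bscal_addr, bscal_assoc.
Qed.

Lemma lincomb_0 env : lincomb env (fun _ => 0) = bzero.
Proof.
  induction env as [|v l IH]; simpl; [easy|]. now rewrite IH, bscal_0l, badd_0.
Qed.

Lemma coef_agree_lincomb env c c' : coef_agree env c c' -> lincomb env c = lincomb env c'.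
Proof.
  revert c c'. induction env as [|v l IH]; intros c c'; simpl; [easy|].
  intros [-> H]. f_equal. now apply IH.
Qed.

Lemma lincomb_var env m : lincomb env (fun n => if Nat.eqb n m then 1 else 0) = nth m env bzero.
Proof.
  revert m. induction env as [|v l IH]; intros [|m]; simpl; try easy.
  - now rewrite lincomb_0, bscal_1, badd_0.
  - now rewrite IH, bscal_0l, badd_comm, badd_0.
Qed.

Lemma vden_lincomb env e : vden env e = lincomb env (vcoef e).
Proof.
  induction e; simpl.
  - symmetry; apply lincomb_0.
  - symmetry; apply lincomb_var.
  - now rewrite IHe1, IHe2, lincomb_add.
  - rewrite IHe, bopp_scal, <- lincomb_scal. f_equal.
    apply functional_extensionality; intros n; lra.
  - now rewrite IHe, lincomb_scal.
Qed.

Lemma vden_eq env e e' : coef_agree env (vcoef e) (vcoef e') -> vden env e = vden env e'.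
Proof. intros H. rewrite !vden_lincomb. now apply coef_agree_lincomb. Qed.

End VectorIdentities.

Ltac vec_in x l :=
  lazymatch l with
  | nil => constr:(false)
  | x :: _ => constr:(true)
  | _ :: ?l' => vec_in x l'
  end.

Ltac vec_atoms t l :=
  lazymatch t with
  | badd ?a ?b => let l' := vec_atoms a l in vec_atoms b l'
  | bopp ?a => vec_atoms a l
  | bscal _ ?a => vec_atoms a l
  | bzero => l
  | _ => lazymatch vec_in t l with true => l | false => constr:(t :: l) end
  end.

Ltac vec_index x l :=
  lazymatch l with
  | x :: _ => constr:(O)
  | _ :: ?l' => let n := vec_index x l' in constr:(S n)
  end.

Ltac vec_reify t l :=
  lazymatch t with
  | badd ?a ?b => let a' := vec_reify a l in let b' := vec_reify b l in constr:(VAdd a' b')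
  | bopp ?a => let a' := vec_reify a l in constr:(VOpp a')
  | bscal ?r ?a => let a' := vec_reify a l in constr:(VScal r a')
  | bzero => constr:(VZero)
  | _ => let n := vec_index t l in constr:(VVar n)
  end.

(** Proves equalities of linear combinations by comparing coefficients. *)
Ltac vec_with tac :=
  unfold bsub in *;
  lazymatch goal with
  | |- @eq (bcar ?E) ?x ?y =>
      let l := vec_atoms x (@nil (bcar E)) in
      let l := vec_atoms y l in
      let x' := vec_reify x l in
      let y' := vec_reify y l in
      change (@vden E l x' = @vden E l y'); apply vden_eq;
      cbv [coef_agree vcoef Nat.eqb]; repeat (split; [tac|]); exact I
  end.
Ltac vec := vec_with ltac:(ring).
Ltac vecf := vec_with ltac:(field; lra).

Section Norms.
Context {E : BanachSpace}.
Implicit Types x y z : E.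

Lemma bnorm_0 : bnorm (@bzero E) = 0.
Proof. rewrite <- (bscal_0l bzero), bnorm_scal, Rabs_R0. lra. Qed.

Lemma bnorm_opp x : bnorm (bopp x) = bnorm x.
Proof. rewrite bopp_scal, bnorm_scal, (Rabs_left (-1)) by lra. lra. Qed.

Lemma bnorm_ge0 x : 0 <= bnorm x.
Proof.
  pose proof (bnorm_triangle _ x (bopp x)) as H.
  rewrite badd_opp, bnorm_0, bnorm_opp in H. lra.
Qed.

Lemma bnorm_sub x y : bnorm (bsub x y) <= bnorm x + bnorm y.
Proof. unfold bsub. rewrite <- (bnorm_opp y). apply bnorm_triangle. Qed.

Lemma bnorm_sub_sym x y : bnorm (bsub x y) = bnorm (bsub y x).
Proof. rewrite <- bnorm_opp. f_equal. vec. Qed.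

Lemma bnorm_sub_le x y z : bnorm (bsub x z) <= bnorm (bsub x y) + bnorm (bsub y z).
Proof. replace (bsub x z) with (badd (bsub x y) (bsub y z)) by vec. apply bnorm_triangle. Qed.

Lemma bnorm_le_sub x y : bnorm x <= bnorm y + bnorm (bsub x y).
Proof.
  replace x with (badd y (bsub x y)) at 1 by vec. apply bnorm_triangle.
Qed.

Lemma bnorm_scal_pos t x : 0 <= t -> bnorm (bscal t x) = t * bnorm x.
Proof. intros H. now rewrite bnorm_scal, Rabs_right by lra. Qed.

Lemma bsub_eq0 x y : bsub x y = bzero -> x = y.
Proof. intros H. replace x with (badd (bsub x y) y) by vec. rewrite H. vec. Qed.

Lemma bnorm_sub_eq x y : (forall eps, 0 < eps -> bnorm (bsub x y) <= eps) -> x = y.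
Proof.
  intros H. apply bsub_eq0, bnorm_eq0. pose proof (bnorm_ge0 (bsub x y)).
  apply Rle_antisym; [|lra]. apply le_epsilon. intros e He. specialize (H e He). lra.
Qed.

(** Step bounds of the form [r n - r (S n)] telescope, so the distance to the limit is at most [r n]
    and no series has to be summed. The factors [4 * INR N] and [6 * tau] of later iterations arise
    as such [r]. *)
Lemma telescoping_cauchy (u : nat -> E) (r : nat -> R) :
  (forall n, 0 <= r n) ->
  (forall eps, 0 < eps -> exists N, r N < eps) ->
  (forall n, bnorm (bsub (u (S n)) (u n)) <= r n - r (S n)) ->
  exists l, forall n, bnorm (bsub l (u n)) <= r n.
Proof.
  intros Hr0 Hr Hu.
  assert (Hk : forall n k, bnorm (bsub (u (n + k)%nat) (u n)) <= r n - r (n + k)%nat).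
  { intros n k. induction k as [|k IH].
    - rewrite Nat.add_0_r. unfold bsub. rewrite badd_opp, bnorm_0. lra.
    - rewrite Nat.add_succ_r. pose proof (bnorm_sub_le (u (S (n + k))) (u (n + k)%nat) (u n)).
      specialize (Hu (n + k)%nat). lra. }
  destruct (bcomplete E u) as [l Hl].
  { intros eps He. destruct (Hr (eps / 2)) as [N HN]; [lra|].
    exists N. intros m n Hm Hn. change (badd (u m) (bopp (u n))) with (bsub (u m) (u n)).
    pose proof (Hk N (m - N)%nat) as H1. pose proof (Hk N (n - N)%nat) as H2.
    replace (N + (m - N))%nat with m in H1 by lia.
    replace (N + (n - N))%nat with n in H2 by lia.
    pose proof (bnorm_sub_le (u m) (u N) (u n)). rewrite (bnorm_sub_sym (u N)) in H.
    pose proof (Hr0 m). pose proof (Hr0 n). lra. }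
  exists l. intros n. apply le_epsilon. intros e He. destruct (Hl e He) as [N HN].
  specialize (HN (n + N)%nat ltac:(lia)).
  change (bnorm (bsub (u (n + N)%nat) l) < e) in HN.
  pose proof (bnorm_sub_le l (u (n + N)%nat) (u n)). rewrite (bnorm_sub_sym l (u (n + N)%nat)) in H.
  pose proof (Hk n N). pose proof (Hr0 (n + N)%nat). lra.
Qed.

End Norms.

Lemma half_pow_small (c eps : R) : 0 < eps -> exists N, c * (/ 2) ^ N < eps.
Proof.
  intros He. assert (Hc : 0 < Rabs c + 1) by (pose proof (Rabs_pos c); lra).
  destruct (pow_lt_1_zero (/ 2)) with (y := eps / (Rabs c + 1)) as [N HN].
  - rewrite Rabs_right; lra.
  - now apply Rdiv_lt_0_compat.
  - exists N. specialize (HN N (Nat.le_refl N)).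
    assert (Hp : 0 < (/ 2) ^ N) by (apply pow_lt; lra).
    rewrite Rabs_right in HN by lra.
    apply (Rmult_lt_compat_r (Rabs c + 1)) in HN; [|lra].
    unfold Rdiv in HN. rewrite Rmult_assoc, Rinv_l, Rmult_1_r in HN by lra.
    pose proof (Rle_abs c). nra.
Qed.

Lemma dependent_choice_nat (A : Type) (P : nat -> A -> Prop) (Q : nat -> A -> A -> Prop) (a0 : A) :
  P O a0 -> (forall n a, P n a -> exists b, P (S n) b /\ Q n a b) ->
  exists u : nat -> A, u O = a0 /\ forall n, P n (u n) /\ Q n (u n) (u (S n)).
Proof.
  intros H0 HS.
  pose (next := fun n (s : {a | P n a}) =>
    constructive_indefinite_description _ (HS n (proj1_sig s) (proj2_sig s))).
  pose (v := fix v n : {a | P n a} :=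
    match n with
    | O => exist _ a0 H0
    | S k => exist _ (proj1_sig (next k (v k))) (proj1 (proj2_sig (next k (v k))))
    end).
  exists (fun n => proj1_sig (v n)). split; [reflexivity|].
  intros n. split; [apply proj2_sig|]. exact (proj2 (proj2_sig (next n (v n)))).
Qed.

(** * Dual and product spaces *)

Section Functionals.
Context {E : BanachSpace}.
Implicit Types (f g : E -> R) (x y : E).

Lemma dual_add f x y : is_dual f -> f (badd x y) = f x + f y.
Proof. intros H; apply H. Qed.

Lemma dual_scal f t x : is_dual f -> f (bscal t x) = t * f x.
Proof. intros H; apply H. Qed.

Lemma dual_opp f x : is_dual f -> f (bopp x) = - f x.
Proof. intros H. rewrite bopp_scal, dual_scal by exact H. lra. Qed.

Lemma dual_sub f x y : is_dual f -> f (bsub x y) = f x - f y.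
Proof. intros H. unfold bsub. rewrite dual_add, dual_opp by exact H. lra. Qed.

Lemma dual_0 f : is_dual f -> f bzero = 0.
Proof. intros H. rewrite <- (bscal_0l bzero), dual_scal by exact H. lra. Qed.

Lemma dual_has_bound f : is_dual f -> exists r, dual_bound r f.
Proof.
  intros (_ & _ & M & HM). exists (Rmax 0 M). split; [apply Rmax_l|].
  intros x. apply Rle_trans with (1 := HM x).
  apply Rmult_le_compat_r; [apply bnorm_ge0 | apply Rmax_r].
Qed.

Lemma is_dual_intro f r :
  (forall x y, f (badd x y) = f x + f y) -> (forall t x, f (bscal t x) = t * f x) ->
  dual_bound r f -> is_dual f.
Proof. intros H1 H2 H3. split; [exact H1|split; [exact H2|]]. exists r. apply H3. Qed.

Lemma dual_bound_add r s f g :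
  dual_bound r f -> dual_bound s g -> dual_bound (r + s) (fun u => f u + g u).
Proof.
  intros [H1 H2] [H3 H4]. split; [lra|]. intros x.
  specialize (H2 x). specialize (H4 x). pose proof (Rabs_triang (f x) (g x)). lra.
Qed.

Lemma dual_bound_scal r t f : dual_bound r f -> dual_bound (Rabs t * r) (fun u => t * f u).
Proof.
  intros [H1 H2]. split; [apply Rmult_le_pos; [apply Rabs_pos|lra]|]. intros x.
  rewrite Rabs_mult, Rmult_assoc. apply Rmult_le_compat_l; [apply Rabs_pos|apply H2].
Qed.

Lemma dual_bound_le r s f : r <= s -> dual_bound r f -> dual_bound s f.
Proof.
  intros H [H1 H2]. split; [lra|]. intros x. specialize (H2 x).
  pose proof (bnorm_ge0 x). nra.
Qed.

Lemma is_dual_add f g : is_dual f -> is_dual g -> is_dual (fun u => f u + g u).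
Proof.
  intros Hf Hg. destruct (dual_has_bound _ Hf) as [r Hr].
  destruct (dual_has_bound _ Hg) as [s Hs].
  apply is_dual_intro with (r + s).
  - intros x y. rewrite !dual_add by assumption. ring.
  - intros t x. rewrite !dual_scal by assumption. ring.
  - now apply dual_bound_add.
Qed.

Lemma is_dual_scal t f : is_dual f -> is_dual (fun u => t * f u).
Proof.
  intros Hf. destruct (dual_has_bound _ Hf) as [r Hr].
  apply is_dual_intro with (Rabs t * r).
  - intros x y. rewrite !dual_add by assumption. ring.
  - intros s x. rewrite !dual_scal by assumption. ring.
  - now apply dual_bound_scal.
Qed.

Lemma is_dual_opp f : is_dual f -> is_dual (fun u => - f u).
Proof.
  intros H. replace (fun u => - f u) with (fun u => -1 * f u).
  - now apply is_dual_scal.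
  - apply functional_extensionality; intros u; ring.
Qed.

Lemma is_dual_sub f g : is_dual f -> is_dual g -> is_dual (fun u => f u - g u).
Proof. intros Hf Hg. exact (is_dual_add _ _ Hf (is_dual_opp _ Hg)). Qed.

Lemma is_dual_zero : is_dual (fun _ : E => 0).
Proof.
  apply is_dual_intro with 0; try (intros; ring).
  split; [lra|]. intros x. rewrite Rabs_R0. lra.
Qed.

(** [p] need not be a norm; [dual_bound] is the case [p = bnorm]. *)
Lemma least_bound (p a : E -> R) :
  (exists r, 0 <= r /\ forall u, Rabs (a u) <= r * p u) ->
  (forall u, 0 <= p u) ->
  exists q, 0 <= q /\ (forall u, Rabs (a u) <= q * p u) /\
    forall r, 0 <= r -> (forall u, Rabs (a u) <= r * p u) -> q <= r.
Proof.
  intros [r0 Hr0] Hp.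
  destruct (completeness (fun s => 0 <= - s /\ forall u, Rabs (a u) <= (- s) * p u)) as [m [Hm1 Hm2]].
  - exists 0. intros s [Hs _]. lra.
  - exists (- r0). now rewrite Ropp_involutive.
  - exists (- m). split; [|split].
    + enough (m <= 0) by lra. apply Hm2. intros s [Hs _]. lra.
    + intros u. destruct (Req_dec (p u) 0) as [H0|H0].
      (* Where [p u = 0] no division is possible, but the given bound already forces [a u = 0]. *)
      * destruct Hr0 as [_ Hr]. specialize (Hr u). rewrite H0 in *. lra.
      * assert (Hpu : 0 < p u) by (specialize (Hp u); lra).
        enough (m <= - (Rabs (a u) / p u)).
        { apply Rmult_le_reg_r with (/ p u); [now apply Rinv_0_lt_compat|].
          rewrite Rmult_assoc, Rinv_r by lra. unfold Rdiv in H. lra. }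
        apply Hm2. intros s [_ Hs]. specialize (Hs u).
        apply (Rmult_le_compat_r (/ p u)) in Hs; [|left; now apply Rinv_0_lt_compat].
        rewrite Rmult_assoc, Rinv_r in Hs by lra. unfold Rdiv. lra.
    + intros r Hr1 Hr2. enough (- r <= m) by lra. apply Hm1. now rewrite Ropp_involutive.
Qed.

Lemma dual_norm_ex f : is_dual f ->
  exists q, dual_bound q f /\ forall r, dual_bound r f -> q <= r.
Proof.
  intros Hf. destruct (least_bound bnorm f) as (q & H1 & H2 & H3).
  - now apply dual_has_bound.
  - apply bnorm_ge0.
  - exists q. split; [now split|]. intros r [Hr1 Hr2]. now apply H3.
Qed.

Definition dual_car : Type := {f : E -> R | is_dual f}.

Definition dual_norm (f : dual_car) : R :=
  proj1_sig (constructive_indefinite_description _ (dual_norm_ex _ (proj2_sig f))).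

Lemma dual_norm_bound (f : dual_car) : dual_bound (dual_norm f) (proj1_sig f).
Proof. unfold dual_norm. destruct constructive_indefinite_description as [q Hq]. apply Hq. Qed.

Lemma dual_norm_least (f : dual_car) r : dual_bound r (proj1_sig f) -> dual_norm f <= r.
Proof. unfold dual_norm. destruct constructive_indefinite_description as [q Hq]. apply Hq. Qed.

Lemma dual_norm_ge0 (f : dual_car) : 0 <= dual_norm f.
Proof. apply dual_norm_bound. Qed.

Lemma dual_car_ext (f g : dual_car) : (forall x, proj1_sig f x = proj1_sig g x) -> f = g.
Proof.
  destruct f as [f Hf], g as [g Hg]; simpl. intros H.
  apply functional_extensionality in H. subst. f_equal. apply proof_irrelevance.
Qed.

Definition dual_mk f (H : is_dual f) : dual_car := exist _ f H.

Definition dual_car_add (f g : dual_car) : dual_car :=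
  dual_mk _ (is_dual_add _ _ (proj2_sig f) (proj2_sig g)).
Definition dual_car_scal (t : R) (f : dual_car) : dual_car :=
  dual_mk _ (is_dual_scal t _ (proj2_sig f)).

Lemma dual_norm_scal_le t (f : dual_car) : dual_norm (dual_car_scal t f) <= Rabs t * dual_norm f.
Proof. apply dual_norm_least, dual_bound_scal, dual_norm_bound. Qed.

Lemma dual_norm_scal t (f : dual_car) : dual_norm (dual_car_scal t f) = Rabs t * dual_norm f.
Proof.
  apply Rle_antisym; [apply dual_norm_scal_le|].
  destruct (Req_dec t 0) as [->|Ht].
  - rewrite Rabs_R0. pose proof (dual_norm_ge0 (dual_car_scal 0 f)). lra.
  - replace f with (dual_car_scal (/ t) (dual_car_scal t f)) at 1
      by (apply dual_car_ext; intros x; simpl; field; exact Ht).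
    pose proof (dual_norm_scal_le (/ t) (dual_car_scal t f)) as H.
    apply (Rmult_le_compat_l (Rabs t)) in H; [|apply Rabs_pos].
    rewrite <- Rmult_assoc, <- Rabs_mult, Rinv_r, Rabs_R1 in H by exact Ht. lra.
Qed.

Lemma dual_complete (u : nat -> dual_car) :
  (forall eps, 0 < eps -> exists N, forall m n, (N <= m)%nat -> (N <= n)%nat ->
     dual_norm (dual_car_add (u m) (dual_car_scal (-1) (u n))) < eps) ->
  exists l, forall eps, 0 < eps -> exists N, forall n, (N <= n)%nat ->
     dual_norm (dual_car_add (u n) (dual_car_scal (-1) l)) < eps.
Proof.
  intros Hu.
  assert (Hpt : forall eps, 0 < eps -> exists N, forall m n x, (N <= m)%nat -> (N <= n)%nat ->
     Rabs (proj1_sig (u m) x - proj1_sig (u n) x) <= eps * bnorm x).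
  { intros eps He. destruct (Hu eps He) as [N HN]. exists N. intros m n x Hm Hn.
    specialize (HN m n Hm Hn).
    destruct (dual_norm_bound (dual_car_add (u m) (dual_car_scal (-1) (u n)))) as [_ H].
    specialize (H x). simpl in H. pose proof (bnorm_ge0 x).
    replace (proj1_sig (u m) x - proj1_sig (u n) x)
      with (proj1_sig (u m) x + -1 * proj1_sig (u n) x) by ring.
    nra. }
  assert (Hlim : forall x, {l | Un_cv (fun n => proj1_sig (u n) x) l}).
  { intros x. apply R_complete. intros eps He.
    pose proof (bnorm_ge0 x) as Hx.
    destruct (Hpt (eps / (2 * (bnorm x + 1)))) as [N HN].
    { apply Rdiv_lt_0_compat; lra. }
    exists N. intros n m Hn Hm. unfold Rdist. apply Rle_lt_trans with (1 := HN n m x Hn Hm).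
    apply Rlt_le_trans with (eps / (2 * (bnorm x + 1)) * (2 * (bnorm x + 1))).
    - apply Rmult_lt_compat_l; [apply Rdiv_lt_0_compat|]; lra.
    - right. field. lra. }
  pose (l := fun x => proj1_sig (Hlim x)).
  assert (Hl : forall x, Un_cv (fun n => proj1_sig (u n) x) (l x)) by (intros x; apply (proj2_sig (Hlim x))).
  assert (Hlu : forall eps, 0 < eps -> exists N, forall n x, (N <= n)%nat ->
     Rabs (proj1_sig (u n) x - l x) <= eps * bnorm x).
  { intros eps He. destruct (Hpt eps He) as [N HN]. exists N. intros n x Hn.
    apply le_epsilon. intros e2 He2. destruct (Hl x e2 He2) as [N2 HN2].
    specialize (HN2 (max N N2) ltac:(lia)). unfold Rdist in HN2.
    specialize (HN n (max N N2) x Hn ltac:(lia)).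
    pose proof (Rabs_triang (proj1_sig (u n) x - proj1_sig (u (max N N2)) x)
                            (proj1_sig (u (max N N2)) x - l x)).
    replace (proj1_sig (u n) x - proj1_sig (u (max N N2)) x + (proj1_sig (u (max N N2)) x - l x))
      with (proj1_sig (u n) x - l x) in H by ring. lra. }
  assert (Hdl : is_dual l).
  { destruct (Hlu 1 Rlt_0_1) as [N HN].
    apply is_dual_intro with (dual_norm (u N) + 1).
    - intros x y. apply UL_sequence with (1 := Hl (badd x y)).
      replace (fun n => proj1_sig (u n) (badd x y))
        with (fun n => proj1_sig (u n) x + proj1_sig (u n) y).
      + now apply CV_plus.
      + apply functional_extensionality; intros n. now rewrite dual_add by apply proj2_sig.
    - intros t x. apply UL_sequence with (1 := Hl (bscal t x)).
      replace (fun n => proj1_sig (u n) (bscal t x)) with (fun n => t * proj1_sig (u n) x).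
      + apply CV_mult; [|apply Hl]. intros e He. exists O. intros n _.
        unfold Rdist. rewrite Rminus_diag, Rabs_R0. lra.
      + apply functional_extensionality; intros n. now rewrite dual_scal by apply proj2_sig.
    - split; [pose proof (dual_norm_ge0 (u N)); lra|]. intros x.
      specialize (HN N x (Nat.le_refl N)).
      destruct (dual_norm_bound (u N)) as [_ Hb]. specialize (Hb x).
      pose proof (Rabs_triang (proj1_sig (u N) x) (- (proj1_sig (u N) x - l x))).
      rewrite Rabs_Ropp in H.
      replace (proj1_sig (u N) x + - (proj1_sig (u N) x - l x)) with (l x) in H by ring. lra. }
  exists (dual_mk l Hdl). intros eps He. destruct (Hlu (eps / 2)) as [N HN]; [lra|].
  exists N. intros n Hn. apply Rle_lt_trans with (eps / 2); [|lra].
  apply dual_norm_least. split; [lra|]. intros x. simpl.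
  replace (proj1_sig (u n) x + -1 * l x) with (proj1_sig (u n) x - l x) by ring. now apply HN.
Qed.

End Functionals.
Arguments dual_car : clear implicits.

Definition dual_space (E : BanachSpace) : BanachSpace.
Proof.
  refine {| bcar := dual_car E; bzero := dual_mk _ is_dual_zero; badd := dual_car_add;
            bopp := dual_car_scal (-1); bscal := dual_car_scal; bnorm := dual_norm |};
    try (intros; apply dual_car_ext; intros u; simpl; ring).
  - intros f Hf. apply dual_car_ext. intros u. simpl.
    destruct (dual_norm_bound f) as [_ H]. specialize (H u). rewrite Hf in H.
    apply NNPP. intros Hu. apply Rabs_pos_lt in Hu. lra.
  - apply dual_norm_scal.
  - intros f g. apply dual_norm_least. apply dual_bound_add; apply dual_norm_bound.
  - apply dual_complete.
Defined.

(** The sum norm makes both coordinate slices isometric, so a functional on the product restricts to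
    each factor with the same bound. The definition is transparent because later proofs unfold its
    projections. *)
Definition prod_space (E F : BanachSpace) : BanachSpace.
Proof.
  refine {| bcar := (E * F)%type; bzero := (bzero, bzero);
            badd := fun u v => (badd (fst u) (fst v), badd (snd u) (snd v));
            bopp := fun u => (bopp (fst u), bopp (snd u));
            bscal := fun t u => (bscal t (fst u), bscal t (snd u));
            bnorm := fun u => bnorm (fst u) + bnorm (snd u) |};
    try (intros; repeat match goal with v : (_ * _)%type |- _ => destruct v end; simpl; f_equal; vec).
  - intros [x y]; simpl; intros H. pose proof (bnorm_ge0 x). pose proof (bnorm_ge0 y).
    f_equal; apply bnorm_eq0; lra.
  - intros t [x y]; simpl. rewrite !bnorm_scal. ring.
  - intros [x y] [z w]; simpl. pose proof (bnorm_triangle _ x z). pose proof (bnorm_triangle _ y w). lra.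
  - intros u Hu.
    destruct (bcomplete E (fun n => fst (u n))) as [l Hl].
    { intros eps He. destruct (Hu eps He) as [N HN]. exists N. intros m n Hm Hn.
      specialize (HN m n Hm Hn). simpl in HN.
      pose proof (bnorm_ge0 (badd (snd (u m)) (bopp (snd (u n))))). lra. }
    destruct (bcomplete F (fun n => snd (u n))) as [l' Hl'].
    { intros eps He. destruct (Hu eps He) as [N HN]. exists N. intros m n Hm Hn.
      specialize (HN m n Hm Hn). simpl in HN.
      pose proof (bnorm_ge0 (badd (fst (u m)) (bopp (fst (u n))))). lra. }
    exists (l, l'). intros eps He. destruct (Hl (eps / 2)) as [N HN]; [lra|].
    destruct (Hl' (eps / 2)) as [N' HN']; [lra|].
    exists (max N N'). intros n Hn. simpl.
    specialize (HN n ltac:(lia)). specialize (HN' n ltac:(lia)). simpl in *. lra.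
Defined.

(** * Hahn-Banach *)

Definition linear_fun {E : BanachSpace} (f : E -> R) : Prop :=
  (forall x y, f (badd x y) = f x + f y) /\ (forall t x, f (bscal t x) = t * f x).

(* A sublinear functional is encoded by its epigraph cone. *)
Record epi_cone {E : BanachSpace} (S : E -> R -> Prop) : Prop := {
  epi_add : forall x a y b, S x a -> S y b -> S (badd x y) (a + b);
  epi_scal : forall t x a, 0 < t -> S x a -> S (bscal t x) (t * a);
  epi_pos : forall a, S bzero a -> 0 <= a;
  epi_0 : S bzero 0;
  epi_total : forall x, exists a, S x a
}.

(** A larger epigraph is a smaller functional, so a maximal cone encodes a minimal sublinear
    functional below the given one. *)
Lemma maximal_epi_cone {E : BanachSpace} (S : E -> R -> Prop) : epi_cone S ->
  exists M : E -> R -> Prop, epi_cone M /\ (forall x a, S x a -> M x a) /\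
    forall N : E -> R -> Prop, epi_cone N -> (forall x a, M x a -> N x a) -> forall x a, N x a -> M x a.
Proof.
  intros HS.
  (* The guard [exists p, A p] lets the union of the empty chain satisfy the predicate; [Hne] below
     excludes the empty set as the maximal one. *)
  destruct (@classical_sets.Zorn_bigcup (E * R)
    (fun A => (exists p, A p) -> epi_cone (fun x a => A (x, a)) /\ forall x a, S x a -> A (x, a)))
    as [A [HA Hmax]].
  - intros F HF Htot [p [A0 HA0 HpA0]].
    pose proof (HF _ HA0 (ex_intro _ _ HpA0)) as [G0 C0].
    assert (Hg : forall A q, F A -> A q -> epi_cone (fun x a => A (x, a))).
    { intros A q HFA Hq. exact (proj1 (HF _ HFA (ex_intro _ _ Hq))). }
    split.
    + constructor.
      * intros x a y b [B HB HBx] [C HC HCy].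
        destruct (Htot _ _ HB HC) as [H|H].
        -- exists C; [exact HC|]. now apply (epi_add _ (Hg _ _ HC HCy)); [apply H|].
        -- exists B; [exact HB|]. now apply (epi_add _ (Hg _ _ HB HBx)); [|apply H].
      * intros t x a Ht [B HB HBx]. exists B; [exact HB|]. now apply (epi_scal _ (Hg _ _ HB HBx)).
      * intros a [B HB HBx]. now apply (epi_pos _ (Hg _ _ HB HBx)).
      * exists A0; [exact HA0|]. apply C0, epi_0, HS.
      * intros x. destruct (epi_total _ HS x) as [a Ha]. exists a, A0; [exact HA0|]. now apply C0.
    + intros x a Ha. exists A0; [exact HA0|]. now apply C0.
  - assert (Hne : exists p, A p).
    { apply NNPP. intros He. apply (Hmax (fun p => S (fst p) (snd p))).
      - split; [|intros H; apply He; exists (bzero, 0); apply H, epi_0, HS].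
        intros q Hq. exfalso. apply He. now exists q.
      - intros _. split; [exact HS|easy]. }
    destruct (HA Hne) as [H1 H2]. exists (fun x a => A (x, a)). split; [exact H1|split; [exact H2|]].
    intros N HN HAN x a HNx. apply NNPP. intros Hn.
    apply (Hmax (fun p => N (fst p) (snd p))).
    + split; [intros [y b] Hq; now apply HAN|]. intros H. apply Hn, (H (x, a)), HNx.
    + intros _. split; [exact HN|]. intros y b Hy. apply HAN, H2, Hy.
Qed.

(** The fibrewise infimum of a maximal cone is sublinear, and oddness upgrades it to linear:
    superadditivity is subadditivity applied to [x + y] and [- y]. *)
Theorem hahn_banach {E : BanachSpace} (S : E -> R -> Prop) : epi_cone S ->
  exists f, linear_fun f /\ forall x a, S x a -> f x <= a.
Proof.
  intros HS. destruct (maximal_epi_cone S HS) as (M & HM & HSM & Hmax).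
  (* Adjoining [(- x0, - c)] for a lower bound [c] at [x0] keeps [M] a cone, so maximality makes
     the infimum odd. *)
  assert (Hneg : forall x0 c, (forall a, M x0 a -> c <= a) -> M (bopp x0) (- c)).
  { intros x0 c Hc.
    apply (Hmax (fun x b => exists t a, 0 <= t /\ M (badd x (bscal t x0)) a /\ b = a - t * c)).
    - constructor.
      + intros x ? y ? (t & a & Ht & Ha & ->) (s & b & Hs & Hb & ->).
        exists (t + s), (a + b). split; [lra|split; [|ring]].
        replace (badd (badd x y) (bscal (t + s) x0))
          with (badd (badd x (bscal t x0)) (badd y (bscal s x0))) by vec.
        now apply (epi_add _ HM).
      + intros r x ? Hr (t & a & Ht & Ha & ->). exists (r * t), (r * a).
        split; [nra|split; [|ring]].
        replace (badd (bscal r x) (bscal (r * t) x0)) with (bscal r (badd x (bscal t x0))) by vec.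
        now apply (epi_scal _ HM).
      + intros ? (t & a & Ht & Ha & ->).
        destruct (Req_dec t 0) as [->|Hn].
        * replace (badd bzero (bscal 0 x0)) with (@bzero E) in Ha by vec.
          apply (epi_pos _ HM) in Ha. lra.
        * apply (epi_scal _ HM (/ t)) in Ha; [|apply Rinv_0_lt_compat; lra].
          replace (bscal (/ t) (badd bzero (bscal t x0))) with x0 in Ha by vecf.
          apply Hc in Ha. apply (Rmult_le_compat_l t) in Ha; [|lra].
          rewrite <- Rmult_assoc, Rinv_r in Ha by lra. lra.
      + exists 0, 0. split; [lra|split; [|ring]].
        replace (badd bzero (bscal 0 x0)) with (@bzero E) by vec. apply HM.
      + intros x. destruct (epi_total _ HM x) as [a Ha]. exists (a - 0 * c), 0, a.
        split; [lra|split; [|ring]].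
        now replace (badd x (bscal 0 x0)) with x by vec.
    - intros x a Ha. exists 0, a. split; [lra|split; [|ring]].
      now replace (badd x (bscal 0 x0)) with x by vec.
    - exists 1, 0. split; [lra|split; [|ring]].
      replace (badd (bopp x0) (bscal 1 x0)) with (@bzero E) by vec. apply HM. }
  assert (Hinf : forall x, {c | (forall a, M x a -> c <= a) /\
                                forall d, (forall a, M x a -> d <= a) -> d <= c}).
  { intros x. destruct (completeness (fun s => M x (- s))) as [m [Hm1 Hm2]].
    - destruct (epi_total _ HM (bopp x)) as [b Hb]. exists b. intros s Hs.
      pose proof (epi_add _ HM _ _ _ _ Hs Hb) as H.
      replace (badd x (bopp x)) with (@bzero E) in H by vec. apply (epi_pos _ HM) in H. lra.
    - destruct (epi_total _ HM x) as [a Ha]. exists (- a). now rewrite Ropp_involutive.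
    - exists (- m). split.
      + intros a Ha. enough (- a <= m) by lra. apply Hm1. now rewrite Ropp_involutive.
      + intros d Hd. enough (m <= - d) by lra. apply Hm2. intros s Hs. specialize (Hd _ Hs). lra. }
  pose (f := fun x => proj1_sig (Hinf x)).
  assert (Hf1 : forall x a, M x a -> f x <= a) by (intros x; apply (proj1 (proj2_sig (Hinf x)))).
  assert (Hf2 : forall x d, (forall a, M x a -> d <= a) -> d <= f x)
    by (intros x; apply (proj2 (proj2_sig (Hinf x)))).
  clearbody f.
  assert (Hsub : forall x y, f (badd x y) <= f x + f y).
  { intros x y. enough (f (badd x y) - f y <= f x) by lra. apply Hf2. intros a Ha.
    enough (f (badd x y) - a <= f y) by lra. apply Hf2. intros b Hb.
    enough (f (badd x y) <= a + b) by lra. apply Hf1. now apply (epi_add _ HM). }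
  assert (H0 : f bzero = 0).
  { apply Rle_antisym; [apply Hf1, HM|apply Hf2, HM]. }
  assert (Hopp : forall x, f (bopp x) = - f x).
  { intros x. apply Rle_antisym.
    - apply Hf1, Hneg, Hf1.
    - specialize (Hsub x (bopp x)). replace (badd x (bopp x)) with (@bzero E) in Hsub by vec. lra. }
  assert (Hpos : forall t x, 0 < t -> f (bscal t x) = t * f x).
  { assert (Hle : forall t x, 0 < t -> f (bscal t x) <= t * f x).
    { intros t x Ht. enough (/ t * f (bscal t x) <= f x).
      { apply (Rmult_le_compat_l t) in H; [|lra]. rewrite <- Rmult_assoc, Rinv_r in H by lra. lra. }
      apply Hf2. intros a Ha. apply (epi_scal _ HM t) in Ha; [|exact Ht]. apply Hf1 in Ha.
      apply (Rmult_le_compat_l (/ t)) in Ha; [|left; now apply Rinv_0_lt_compat].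
      rewrite <- (Rmult_assoc _ t), Rinv_l in Ha by lra. lra. }
    intros t x Ht. apply Rle_antisym; [now apply Hle|].
    pose proof (Hle (/ t) (bscal t x) ltac:(now apply Rinv_0_lt_compat)) as H.
    replace (bscal (/ t) (bscal t x)) with x in H by vecf.
    apply (Rmult_le_compat_l t) in H; [|lra]. rewrite <- Rmult_assoc, Rinv_r in H by lra. lra. }
  exists f. split; [split|].
  - intros x y. apply Rle_antisym; [apply Hsub|].
    pose proof (Hsub (badd x y) (bopp y)) as H.
    replace (badd (badd x y) (bopp y)) with x in H by vec. rewrite Hopp in H. lra.
  - intros t x. destruct (Rtotal_order t 0) as [Ht|[->|Ht]].
    + replace (bscal t x) with (bopp (bscal (- t) x)) by vec.
      rewrite Hopp, Hpos by lra. ring.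
    + rewrite bscal_0l, H0. ring.
    + now apply Hpos.
  - intros x a Ha. apply Hf1, HSM, Ha.
Qed.

(** [K v r] says that [r] is an admissible value at [v]. Convex functions are given by relations so
    that partial infima and infinite values never have to be formed. *)
Definition convex_rel {E : BanachSpace} (K : E -> R -> Prop) : Prop :=
  forall v r w s t, K v r -> K w s -> 0 <= t <= 1 ->
    K (badd (bscal t v) (bscal (1 - t) w)) (t * r + (1 - t) * s).

(** Hahn-Banach for the inf-convolution of [L |.|] with the cone generated by [K], that is, the
    infimum of [t r + L |x - t v|]. The lower bound on [K] is what keeps it nonnegative at [0]. *)
Lemma mazur_orlicz {E : BanachSpace} (K : E -> R -> Prop) (L : R) :
  0 <= L -> convex_rel K -> (forall v r, K v r -> 0 <= r + L * bnorm v) ->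
  exists f, is_dual f /\ dual_bound L f /\ forall v r, K v r -> f v <= r.
Proof.
  intros HL HK Hpos.
  destruct (hahn_banach (fun (x : E) a =>
      L * bnorm x <= a \/
      exists t v r, 0 < t /\ K v r /\ t * r + L * bnorm (bsub x (bscal t v)) <= a))
    as [f [[Hadd Hscal] Hf]].
  - assert (Hmix : forall (x y : E) a b t v r, L * bnorm x <= a -> 0 < t -> K v r ->
        t * r + L * bnorm (bsub y (bscal t v)) <= b ->
        t * r + L * bnorm (bsub (badd x y) (bscal t v)) <= a + b).
    { intros x y a b t v r Ha Ht Hv Hb.
      replace (bsub (badd x y) (bscal t v)) with (badd x (bsub y (bscal t v))) by vec.
      pose proof (bnorm_triangle _ x (bsub y (bscal t v))). nra. }
    constructor.
    + intros x a y b [Ha|(t & v & r & Ht & Hv & Ha)] [Hb|(s & w & q & Hs & Hw & Hb)].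
      * left. pose proof (bnorm_triangle _ x y). nra.
      * right. exists s, w, q. split; [exact Hs|split; [exact Hw|]]. now apply Hmix.
      * right. exists t, v, r. split; [exact Ht|split; [exact Hv|]].
        rewrite badd_comm, Rplus_comm. rewrite (Rplus_comm a b). rewrite (Rplus_comm (_ * _)). now apply Hmix.
      * right. exists (t + s), (badd (bscal (t / (t + s)) v) (bscal (1 - t / (t + s)) w)),
          (t / (t + s) * r + (1 - t / (t + s)) * q).
        split; [lra|]. split.
        { apply HK; [exact Hv|exact Hw|].
          assert (0 < / (t + s)) by (apply Rinv_0_lt_compat; lra). unfold Rdiv. split; [nra|].
          apply Rmult_le_reg_r with (t + s); [lra|]. rewrite Rmult_assoc, Rinv_l by lra. lra. }
        replace (bsub (badd x y) (bscal (t + s) (badd (bscal (t / (t + s)) v) (bscal (1 - t / (t + s)) w))))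
          with (badd (bsub x (bscal t v)) (bsub y (bscal s w))) by vecf.
        replace ((t + s) * (t / (t + s) * r + (1 - t / (t + s)) * q)) with (t * r + s * q) by (field; lra).
        pose proof (bnorm_triangle _ (bsub x (bscal t v)) (bsub y (bscal s w))). nra.
    + intros t x a Ht [Ha|(s & v & r & Hs & Hv & Ha)].
      * left. rewrite bnorm_scal_pos by lra. nra.
      * right. exists (t * s), v, r. split; [nra|split; [exact Hv|]].
        replace (bsub (bscal t x) (bscal (t * s) v)) with (bscal t (bsub x (bscal s v))) by vec.
        rewrite bnorm_scal_pos by lra. nra.
    + intros a [Ha|(t & v & r & Ht & Hv & Ha)].
      * rewrite bnorm_0 in Ha. lra.
      * replace (bsub bzero (bscal t v)) with (bopp (bscal t v)) in Ha by vec.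
        rewrite bnorm_opp, bnorm_scal_pos in Ha by lra. specialize (Hpos v r Hv). nra.
    + left. rewrite bnorm_0. lra.
    + intros x. exists (L * bnorm x). left. lra.
  - assert (Hb : forall x, f x <= L * bnorm x) by (intros x; apply Hf; left; lra).
    assert (HB : dual_bound L f).
    { split; [exact HL|]. intros x. apply Rabs_le. split; [|apply Hb].
      specialize (Hb (bopp x)). rewrite bopp_scal, Hscal, <- bopp_scal, bnorm_opp in Hb. lra. }
    exists f. split; [now apply is_dual_intro with L|split; [exact HB|]].
    intros v r Hv. apply Hf. right. exists 1, v, r. split; [lra|split; [exact Hv|]].
    replace (bsub v (bscal 1 v)) with (@bzero E) by vec. rewrite bnorm_0. lra.
Qed.

Definition subspace {E : BanachSpace} (U : E -> Prop) : Prop :=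
  U bzero /\ (forall x y, U x -> U y -> U (badd x y)) /\ (forall t x, U x -> U (bscal t x)).

Lemma subspace_opp {E : BanachSpace} (U : E -> Prop) x : subspace U -> U x -> U (bopp x).
Proof. intros (_ & _ & H) Hx. rewrite bopp_scal. now apply H. Qed.

Lemma subspace_sub {E : BanachSpace} (U : E -> Prop) x y : subspace U -> U x -> U y -> U (bsub x y).
Proof. intros HU Hx Hy. apply HU; [exact Hx|]. now apply subspace_opp. Qed.

(** The upper bound [M] on a ball of [U] and the lower bound [m] at [0] keep [K] above [m - L |v|]
    with [L = 2 (M - m) / delta]; Mazur-Orlicz then yields a subgradient on all of [E], not only on
    [U]. *)
Lemma subgradient_at_0 {E : BanachSpace} (K : E -> R -> Prop) (U : E -> Prop) (M delta m : R) :
  convex_rel K -> subspace U -> (forall v r, K v r -> U v) -> 0 < delta ->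
  (forall u, U u -> bnorm u < delta -> exists r, r <= M /\ K u r) ->
  (forall r, K bzero r -> m <= r) ->
  exists f, is_dual f /\ forall v r, K v r -> f v + m <= r.
Proof.
  intros HK HU HKU Hd HM Hm.
  assert (HmM : m <= M).
  { destruct (HM bzero) as (r & Hr & Hr0); [apply HU|rewrite bnorm_0; lra|]. specialize (Hm r Hr0). lra. }
  destruct (mazur_orlicz (fun v r => K v (r + m)) (2 * (M - m) / delta)) as (f & Hf & _ & Hfr).
  - apply Rmult_le_pos; [lra|]. left. now apply Rinv_0_lt_compat.
  - intros v r w s t Hv Hw Ht.
    replace (t * r + (1 - t) * s + m) with (t * (r + m) + (1 - t) * (s + m)) by ring.
    now apply HK.
  - intros v r Hv. destruct (Req_dec (bnorm v) 0) as [H0|H0].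
    + rewrite H0. apply bnorm_eq0 in H0. subst v. apply Hm in Hv. lra.
    + pose proof (bnorm_ge0 v) as Hn.
      (* [0] lies on the segment from [v] to the point [- c v] of the ball where [K] is bounded *)
      set (c := delta / (2 * bnorm v)).
      assert (Hc : 0 < c) by (apply Rdiv_lt_0_compat; lra).
      assert (Hcv : c * bnorm v = delta / 2) by (unfold c; field; lra).
      destruct (HM (bscal (- c) v)) as (s & Hs & HKs).
      * apply HU, (HKU _ _ Hv).
      * rewrite bnorm_scal, Rabs_Ropp, Rabs_right by lra. lra.
      * assert (Hc1 : 0 < / (1 + c)) by (apply Rinv_0_lt_compat; lra).
        assert (Hc2 : (1 + c) * / (1 + c) = 1) by (apply Rinv_r; lra).
        pose proof (HK _ _ _ _ (c * / (1 + c)) Hv HKs) as H.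
        replace (badd (bscal (c * / (1 + c)) v) (bscal (1 - c * / (1 + c)) (bscal (- c) v)))
          with (@bzero E) in H by vecf.
        specialize (H ltac:(nra)). apply Hm in H.
        assert (Hcr : 0 <= c * r + (s - m)).
        { replace (1 - c * / (1 + c)) with (/ (1 + c)) in H by (field; lra).
          apply Rmult_le_reg_l with (/ (1 + c)); [exact Hc1|].
          replace (/ (1 + c) * (c * r + (s - m))) with (c * / (1 + c) * (r + m) + / (1 + c) * s - m * ((1 + c) * / (1 + c))) by ring.
          rewrite Hc2. lra. }
        apply Rmult_le_reg_l with c; [exact Hc|].
        replace (c * (r + 2 * (M - m) / delta * bnorm v)) with (c * r + 2 * (M - m) / delta * (c * bnorm v)) by ring.
        rewrite Hcv. replace (2 * (M - m) / delta * (delta / 2)) with (M - m) by (field; lra). lra.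
  - exists f. split; [exact Hf|]. intros v r Hv.
    enough (f v <= r - m) by lra. apply Hfr. now replace (r - m + m) with r by ring.
Qed.

(** Mazur-Orlicz on the translate [Z - x1] with constant value [- L]: the functional obtained is
    bounded above on the subspace [Z], hence vanishes there. *)
Lemma separate_subspace {E : BanachSpace} (Z : E -> Prop) (x1 : E) (L : R) :
  subspace Z -> (forall z, Z z -> L <= bnorm (bsub x1 z)) ->
  exists f, is_dual f /\ dual_bound 1 f /\ (forall z, Z z -> f z = 0) /\ L <= f x1.
Proof.
  intros HZ HL.
  destruct (mazur_orlicz (fun v r => exists z, Z z /\ v = bsub z x1 /\ r = - L) 1)
    as (f & Hf & Hfb & Hfr).
  - lra.
  - intros v r w s t (z & Hz & -> & ->) (z' & Hz' & -> & ->) Ht.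
    exists (badd (bscal t z) (bscal (1 - t) z')). split; [|split; [vec|ring]].
    apply HZ; now apply HZ.
  - intros v r (z & Hz & -> & ->). rewrite bnorm_sub_sym. specialize (HL z Hz). lra.
  - assert (Hz : forall z, Z z -> f z - f x1 <= - L).
    { intros z Hz. rewrite <- dual_sub by exact Hf. apply Hfr. now exists z. }
    exists f. split; [exact Hf|split; [exact Hfb|split]].
    + intros z HzZ. apply NNPP. intros Hn.
      specialize (Hz (bscal ((f x1 - L + 1) / f z) z)).
      rewrite dual_scal in Hz by exact Hf. specialize (Hz ltac:(now apply HZ)).
      replace ((f x1 - L + 1) / f z * f z) with (f x1 - L + 1) in Hz by (field; exact Hn). lra.
    + specialize (Hz bzero). rewrite dual_0 in Hz by exact Hf. specialize (Hz ltac:(apply HZ)). lra.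
Qed.

Lemma annihilator_closed {E : BanachSpace} (V : E -> Prop) (y : E) :
  subspace V -> closed_set V -> (forall f : E -> R, is_dual f -> (forall v, V v -> f v = 0) -> f y = 0) -> V y.
Proof.
  intros HV Hcl H. apply NNPP. intros Hy. apply Hy, Hcl. intros eps He.
  apply NNPP. intros Hn.
  destruct (separate_subspace V y eps HV) as (f & Hf & _ & Hf0 & Hfy).
  - intros z Hz. apply Rnot_lt_le. intros Hlt. apply Hn. exists z. split; [exact Hz|].
    now rewrite bnorm_sub_sym.
  - rewrite (H f Hf Hf0) in Hfy. lra.
Qed.

(** * Finitely many functionals, the bidual and Helly's theorem *)

Definition ker_all {E : BanachSpace} (l : list (E -> R)) (x : E) : Prop := forall f, In f l -> f x = 0.

Lemma subspace_ker_all {E : BanachSpace} (l : list (E -> R)) :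
  (forall f, In f l -> is_dual f) -> subspace (ker_all l).
Proof.
  intros Hl. split; [|split].
  - intros f Hf. now apply dual_0, Hl.
  - intros x y Hx Hy f Hf. rewrite dual_add by now apply Hl. rewrite Hx, Hy by exact Hf. lra.
  - intros t x Hx f Hf. rewrite dual_scal by now apply Hl. rewrite Hx by exact Hf. lra.
Qed.

Lemma bidual_scal {E : BanachSpace} (phi : (E -> R) -> R) t f :
  is_bidual phi -> is_dual f -> phi (fun u => t * f u) = t * phi f.
Proof. intros H; apply H. Qed.

Lemma bidual_add {E : BanachSpace} (phi : (E -> R) -> R) f g :
  is_bidual phi -> is_dual f -> is_dual g -> phi (fun u => f u + g u) = phi f + phi g.
Proof. intros H; apply H. Qed.

Lemma bidual_sub {E : BanachSpace} (phi : (E -> R) -> R) f g :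
  is_bidual phi -> is_dual f -> is_dual g -> phi (fun u => f u - g u) = phi f - phi g.
Proof.
  intros H Hf Hg. replace (fun u => f u - g u) with (fun u => f u + -1 * g u).
  - rewrite bidual_add, bidual_scal by auto using is_dual_scal. ring.
  - apply functional_extensionality; intros u; ring.
Qed.

Lemma bidual_bound {E : BanachSpace} (phi : (E -> R) -> R) : is_bidual phi ->
  exists M, 0 <= M /\ forall f r, is_dual f -> dual_bound r f -> Rabs (phi f) <= M * r.
Proof.
  intros (_ & _ & M & HM). exists (Rmax 0 M). split; [apply Rmax_l|].
  intros f r Hf Hr. apply Rle_trans with (1 := HM f r Hf Hr).
  apply Rmult_le_compat_r; [apply Hr|apply Rmax_r].
Qed.

Lemma bidual_eval_shift {E : BanachSpace} (phi : (E -> R) -> R) (s : R) (x : E) :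
  is_bidual phi -> is_bidual (fun f => f x + s * phi f).
Proof.
  intros H. destruct (bidual_bound phi H) as (M & HM0 & HM). split; [|split].
  - intros f g Hf Hg. rewrite (bidual_add phi) by assumption. ring.
  - intros t f Hf. rewrite (bidual_scal phi) by assumption. ring.
  - exists (bnorm x + Rabs s * M). intros f r Hf Hr. specialize (HM f r Hf Hr).
    destruct Hr as [Hr0 Hr]. specialize (Hr x).
    pose proof (Rabs_triang (f x) (s * phi f)). rewrite Rabs_mult in H0.
    pose proof (Rabs_pos s). nra.
Qed.

(** A functional vanishing on the common kernel is a combination of the list. The induction
    eliminates [f1] by means of a vector [z] with [f1 z <> 0], and applying [phi] at each stage
    avoids naming the coefficients. *)
Lemma bidual_ker_all {E : BanachSpace} (phi : (E -> R) -> R) (l : list (E -> R)) (f : E -> R) :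
  is_bidual phi -> (forall g, In g l -> is_dual g /\ phi g = 0) -> is_dual f ->
  (forall x, ker_all l x -> f x = 0) -> phi f = 0.
Proof.
  intros Hphi. revert f. induction l as [|f1 l IH]; intros f Hl Hf Hker.
  - replace f with (fun u : E => 0 * f u).
    + rewrite bidual_scal by assumption. ring.
    + apply functional_extensionality; intros u. rewrite (Hker u) by (intros g []). ring.
  - assert (Hl' : forall g, In g l -> is_dual g /\ phi g = 0) by (intros; apply Hl; now right).
    destruct (Hl f1 (or_introl eq_refl)) as [Hf1 Hp1].
    destruct (classic (forall x, ker_all l x -> f1 x = 0)) as [H1|H1].
    + apply IH; [exact Hl'|exact Hf|]. intros x Hx. apply Hker. intros g [<-|Hg]; auto.
    + apply not_all_ex_not in H1. destruct H1 as [z Hz]. apply imply_to_and in Hz.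
      destruct Hz as [Hz Hfz].
      assert (Hk : phi (fun u => f u - f z / f1 z * f1 u) = 0).
      { apply IH; [exact Hl'|auto using is_dual_sub, is_dual_scal|].
        intros x Hx.
        assert (Hxz : f (bsub x (bscal (f1 x / f1 z) z)) = 0).
        { apply Hker. intros g [<-|Hg].
          - rewrite dual_sub, dual_scal by exact Hf1. field. exact Hfz.
          - rewrite dual_sub, dual_scal, (Hx g Hg), (Hz g Hg) by now apply Hl'. ring. }
        rewrite dual_sub, dual_scal in Hxz by exact Hf.
        rewrite <- Hxz. field. exact Hfz. }
      rewrite bidual_sub, bidual_scal, Hp1 in Hk by auto using is_dual_scal. lra.
Qed.

Lemma bidual_minus_eval {E : BanachSpace} (phi : (E -> R) -> R) (x : E) :
  is_bidual phi -> is_bidual (fun f => phi f - f x).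
Proof.
  intros H. replace (fun f : E -> R => phi f - f x) with (fun f : E -> R => -1 * (f x + -1 * phi f)).
  - pose proof (bidual_eval_shift phi (-1) x H) as H1.
    split; [|split].
    + intros f g Hf Hg. rewrite (bidual_add _ f g H1) by assumption. ring.
    + intros t f Hf. rewrite (bidual_scal _ t f H1) by assumption. ring.
    + destruct (bidual_bound _ H1) as (M & _ & HM). exists M. intros f r Hf Hr.
      rewrite Rabs_mult, (Rabs_left (-1)) by lra. specialize (HM f r Hf Hr). lra.
  - apply functional_extensionality; intros f; ring.
Qed.

(** Linear algebra gives one solution [x1], and the common kernel can be subtracted from it. If no
    solution has norm at most [M + 1], some functional of norm at most one kills the kernel and is
    at least [M + 1] at [x1]; there [phi f = f x1], against the bound [M]. *)
Lemma helly {E : BanachSpace} (phi : (E -> R) -> R) (M : R) (l : list (E -> R)) :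
  is_bidual phi -> (forall f r, is_dual f -> dual_bound r f -> Rabs (phi f) <= M * r) ->
  (forall f, In f l -> is_dual f) ->
  exists x, bnorm x <= M + 1 /\ forall f, In f l -> f x = phi f.
Proof.
  intros Hphi HM Hl.
  assert (Hx1 : exists x1, forall f, In f l -> f x1 = phi f).
  { induction l as [|f l IH]; [exists bzero; intros f []|].
    destruct IH as [x1 Hx1]; [intros; apply Hl; now right|].
    assert (Hf : is_dual f) by (apply Hl; now left).
    assert (Hl' : forall g, In g l -> is_dual g) by (intros; apply Hl; now right).
    destruct (classic (forall x, ker_all l x -> f x = 0)) as [H1|H1].
    - exists x1. intros g [<-|Hg]; [|now apply Hx1].
      pose proof (bidual_ker_all (fun g => phi g - g x1) l f) as H.
      simpl in H. enough (phi f - f x1 = 0) by lra. apply H; auto using bidual_minus_eval.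
      intros g Hg. split; [now apply Hl'|]. rewrite Hx1 by exact Hg. ring.
    - apply not_all_ex_not in H1. destruct H1 as [z Hz]. apply imply_to_and in Hz.
      destruct Hz as [Hz Hfz].
      exists (badd x1 (bscal ((phi f - f x1) / f z) z)).
      intros g [<-|Hg].
      + rewrite dual_add, dual_scal by exact Hf. field. exact Hfz.
      + rewrite dual_add, dual_scal, (Hz g Hg), (Hx1 g Hg) by now apply Hl'. ring. }
  destruct Hx1 as [x1 Hx1].
  apply NNPP. intros Hn.
  destruct (separate_subspace (ker_all l) x1 (M + 1)) as (f & Hf & Hfb & Hf0 & Hfx).
  - now apply subspace_ker_all.
  - intros z Hz. apply Rnot_lt_le. intros Hlt. apply Hn. exists (bsub x1 z). split; [lra|].
    intros f Hf. rewrite dual_sub, (Hz f Hf), (Hx1 f Hf) by now apply Hl. ring.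
  - assert (H : phi f - f x1 = 0).
    { apply (bidual_ker_all (fun g => phi g - g x1) l f); auto using bidual_minus_eval.
      intros g Hg. split; [now apply Hl|]. rewrite Hx1 by exact Hg. ring. }
    specialize (HM f 1 Hf Hfb). pose proof (Rle_abs (phi f)). lra.
Qed.

(** * Convex open mapping theorem *)

Section ConvexOpenMapping.
Context {Z Y : BanachSpace} (C : nat -> Z -> Prop) (q : Z -> Y) (V : Y -> Prop) (L : R).
Hypothesis V_subspace : subspace V.
Hypothesis V_closed : closed_set V.
Hypothesis C_incr : forall n z, C n z -> C (S n) z.
Hypothesis C_convex : forall n, convex_set (C n).
Hypothesis C_closed : forall n, closed_set (C n).
Hypothesis C_bound : forall n z, C n z -> bnorm z <= INR n.
Hypothesis q_affine : forall z w t,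
  q (badd (bscal t z) (bscal (1 - t) w)) = badd (bscal t (q z)) (bscal (1 - t) (q w)).
Hypothesis L_pos : 0 <= L.
Hypothesis q_lipschitz : forall z w, bnorm (bsub (q z) (q w)) <= L * bnorm (bsub z w).
Hypothesis q_in_V : forall n z, C n z -> V (q z).
Hypothesis q_absorbs : forall v, V v -> exists lam n z, 0 < lam /\ C n z /\ q z = bscal lam v.

Lemma C_le n m z : (n <= m)%nat -> C n z -> C m z.
Proof. induction 1; auto. Qed.

(** Baire category, run by hand in [V]. The factor [INR (S n)] is there because [q_absorbs] reaches
    only a multiple [lam v]: the dilated images cover [V], the images themselves may not. *)
Lemma somewhere_dense :
  exists n v0 rho, V v0 /\ 0 < rho /\ forall v, V v -> bnorm (bsub v v0) < rho ->
    forall eps, 0 < eps -> exists z, C n z /\ bnorm (bsub (bscal (INR (S n)) (q z)) v) < eps.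
Proof.
  apply NNPP. intros Hno.
  assert (Hstep : forall n v0 rho, V v0 -> 0 < rho -> exists v eps, V v /\ bnorm (bsub v v0) < rho /\
            0 < eps /\ forall z, C n z -> eps <= bnorm (bsub (bscal (INR (S n)) (q z)) v)).
  { intros n v0 rho Hv0 Hrho. apply NNPP. intros Hn. apply Hno.
    exists n, v0, rho. split; [exact Hv0|split; [exact Hrho|]].
    intros v Hv Hvr eps He. apply NNPP. intros Hz. apply Hn. exists v, eps.
    split; [exact Hv|split; [exact Hvr|split; [exact He|]]].
    intros z HzC. apply Rnot_lt_le. intros Hlt. apply Hz. now exists z. }
  (* [snd] is the radius of nested balls. Because of the factor [2], the limit, which lies within
     one radius of the centre, stays a full radius away from the dilated image. *)
  destruct (dependent_choice_nat (Y * R)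
    (fun n a => V (fst a) /\ 0 < snd a /\ snd a <= (/ 2) ^ n)
    (fun n a b => bnorm (bsub (fst b) (fst a)) <= snd a - snd b /\
       forall z, C n z -> 2 * snd b <= bnorm (bsub (bscal (INR (S n)) (q z)) (fst b)))
    (bzero, 1)) as (u & Hu0 & Hu).
  - simpl. split; [apply V_subspace|lra].
  - intros n [v0 rho]; cbn [fst snd]. intros (Hv0 & Hrho & Hn).
    destruct (Hstep n v0 (rho / 2) Hv0) as (v & eps & Hv & Hvr & He & Hz); [lra|].
    exists (v, Rmin (rho / 2) (eps / 2)). cbn [fst snd].
    pose proof (Rmin_l (rho / 2) (eps / 2)). pose proof (Rmin_r (rho / 2) (eps / 2)).
    assert (0 < Rmin (rho / 2) (eps / 2)) by (apply Rmin_pos; lra).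
    assert (HS : (/ 2) ^ S n = (/ 2) ^ n / 2) by (simpl; lra).
    split; [split; [exact Hv|lra]|split; [lra|]].
    intros z HzC. specialize (Hz z HzC). lra.
  - destruct (telescoping_cauchy (fun n => fst (u n)) (fun n => snd (u n))) as [l Hl].
    + intros n. destruct (Hu n) as [(_ & H & _) _]. lra.
    + intros eps He. destruct (half_pow_small 1 eps He) as [N HN]. exists N.
      destruct (Hu N) as [(_ & _ & H) _]. lra.
    + intros n. apply (Hu n).
    + assert (HlV : V l).
      { apply V_closed. intros eps He. destruct (half_pow_small 1 eps He) as [N HN].
        exists (fst (u N)). destruct (Hu N) as [(H1 & _ & H2) _]. split; [exact H1|].
        rewrite bnorm_sub_sym. specialize (Hl N). cbn [fst snd] in *. lra. }
      destruct (q_absorbs l HlV) as (lam & m & z & Hlam & Hz & Hqz).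
      destruct (q_absorbs bzero ltac:(apply V_subspace)) as (lam0 & m0 & z0 & _ & Hz0 & Hqz0).
      rewrite bscal_0r in Hqz0.
      destruct (INR_unbounded (/ lam)) as [k Hk].
      set (n := max k (max m m0)).
      assert (HnR : / lam < INR (S n)).
      { apply Rlt_trans with (1 := Hk). apply lt_INR. unfold n. lia. }
      assert (HSn : 0 < INR (S n)) by (pose proof (Rinv_0_lt_compat _ Hlam); lra).
      (* This [t] satisfies [INR (S n) * lam * t = 1]; mixing with [z0], where [q z0 = 0], places
         [l] itself in the dilated image of [C n]. *)
      set (t := / (INR (S n) * lam)).
      assert (Ht0 : 0 < INR (S n) * lam) by (now apply Rmult_lt_0_compat).
      assert (Ht : 0 <= t <= 1).
      { unfold t. split; [left; now apply Rinv_0_lt_compat|].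
        rewrite <- Rinv_1. apply Rinv_le_contravar; [lra|].
        apply Rmult_lt_compat_r with (r := lam) in HnR; [|exact Hlam].
        rewrite Rinv_l in HnR by lra. lra. }
      assert (HC : C n (badd (bscal t z) (bscal (1 - t) z0))).
      { apply C_convex; [apply C_le with m|apply C_le with m0|exact Ht]; auto; unfold n; lia. }
      destruct (Hu n) as [_ [_ Hfar]]. specialize (Hfar _ HC).
      rewrite q_affine, Hqz, Hqz0 in Hfar.
      replace (bscal (INR (S n)) (badd (bscal t (bscal lam l)) (bscal (1 - t) bzero)))
        with (bscal (INR (S n) * lam * t) l) in Hfar by vec.
      unfold t in Hfar. rewrite Rinv_r, bscal_1 in Hfar by lra.
      specialize (Hl (S n)). destruct (Hu (S n)) as [(_ & H & _) _]. cbn [fst snd] in *. lra.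
Qed.

Lemma dense_ball :
  exists n rho, 0 < rho /\ (exists z, C n z) /\ forall v, V v -> bnorm v < rho ->
    forall eps, 0 < eps -> exists z, C n z /\ bnorm (bsub (q z) v) < eps.
Proof.
  destruct somewhere_dense as (n & v0 & rho & Hv0 & Hrho & Hd).
  destruct (q_absorbs (bopp v0)) as (lam & m & z1 & Hlam & Hz1 & Hq1).
  { now apply subspace_opp. }
  set (N := INR (S n)) in *.
  assert (HN : 0 < N) by (apply lt_0_INR; lia).
  assert (HlN : 0 < lam * N) by (now apply Rmult_lt_0_compat).
  (* This [t] solves [t / N = (1 - t) * lam], so mixing with [z1] cancels the centre [v0]:
     [t q z + (1 - t) q z1] is near [v] once [N q z] is near [v0 + (N / t) v]. *)
  set (t := lam * N / (1 + lam * N)).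
  assert (Ht1 : 0 < t) by (apply Rdiv_lt_0_compat; lra).
  assert (Ht2 : t < 1).
  { unfold t. apply Rmult_lt_reg_r with (1 + lam * N); [lra|].
    unfold Rdiv. rewrite Rmult_assoc, Rinv_l by lra. lra. }
  exists (max n m), (rho * (t / N)).
  assert (HtN : 0 < t / N) by (now apply Rdiv_lt_0_compat).
  split; [nra|split].
  { exists z1. apply C_le with m; [lia|exact Hz1]. }
  intros v Hv Hvr eps He.
  destruct (Hd (badd v0 (bscal (N / t) v))) with (eps := eps * (N / t)) as (z & Hz & Hzv).
  - apply V_subspace; [exact Hv0|]. now apply V_subspace.
  - replace (bsub (badd v0 (bscal (N / t) v)) v0) with (bscal (N / t) v) by vec.
    rewrite bnorm_scal_pos by (left; now apply Rdiv_lt_0_compat).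
    apply Rmult_lt_reg_l with (t / N); [exact HtN|].
    replace (t / N * (N / t * bnorm v)) with (bnorm v) by (field; lra). lra.
  - apply Rmult_lt_0_compat; [exact He|now apply Rdiv_lt_0_compat].
  - exists (badd (bscal t z) (bscal (1 - t) z1)). split.
    + apply C_convex; [apply C_le with n|apply C_le with m|]; auto; try lia. lra.
    + rewrite q_affine, Hq1.
      replace (bsub (badd (bscal t (q z)) (bscal (1 - t) (bscal lam (bopp v0)))) v)
        with (bscal (t / N) (bsub (bscal N (q z)) (badd v0 (bscal (N / t) v)))).
      * rewrite bnorm_scal_pos by lra.
        replace eps with (t / N * (eps * (N / t))) by (field; lra).
        now apply Rmult_lt_compat_l.
      * unfold t. vec_with ltac:(field; lra).
Qed.

(* Robinson's argument: dyadic series of points of [C n] stay in [C n]. *)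
Theorem convex_open_mapping :
  exists n delta, 0 < delta /\ forall v, V v -> bnorm v < delta -> exists z, C n z /\ q z = v.
Proof.
  destruct dense_ball as (N & rho & Hrho & [z0 Hz0] & Hd).
  exists N, (rho / 2). split; [lra|]. intros v Hv Hvr.
  set (th := fun n => (/ 2) ^ n).
  assert (Hth : forall n, 0 < th n <= 1).
  { intros n. unfold th. split; [apply pow_lt; lra|].
    induction n; simpl; [lra|]. assert (0 < (/ 2) ^ n) by (apply pow_lt; lra). lra. }
  assert (HthS : forall n, th (S n) = th n / 2) by (intros n; unfold th; simpl; lra).
  assert (HN : 0 <= INR N) by apply pos_INR.
  (* Invariant: [v] is a mixture of the image of the current point and a remainder [e] of norm below
     [rho / 2], whose weight halves at every step. *)
  destruct (dependent_choice_nat Z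
    (fun n a => C N a /\ exists e, V e /\ bnorm e < rho / 2 /\
       v = badd (bscal (1 - th n) (q a)) (bscal (th n) e))
    (fun n a b => bnorm (bsub b a) <= th n * (2 * INR N)) z0) as (u & _ & Hu).
  - split; [exact Hz0|]. exists v. split; [exact Hv|split; [exact Hvr|]].
    unfold th; simpl. vec.
  - intros n a [Ha (e & He & Her & Hve)].
    destruct (Hd (bscal 2 e)) with (eps := rho / 2) as (z & Hz & Hze).
    + now apply V_subspace.
    + rewrite bnorm_scal_pos by lra. lra.
    + lra.
    + specialize (Hth n). set (t := th n) in *.
      (* Writing [e = (q z + e') / 2] gives [q a] and [q z] the weights [1 - t] and [t / 2];
         normalizing by their sum [1 - t / 2] gives [tau]. *)
      set (tau := t / (2 - t)).
      assert (Htau1 : 0 < tau) by (apply Rdiv_lt_0_compat; lra).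
      assert (Htau2 : tau <= t).
      { unfold tau. apply Rmult_le_reg_r with (2 - t); [lra|].
        unfold Rdiv. rewrite Rmult_assoc, Rinv_l by lra. nra. }
      exists (badd (bscal tau z) (bscal (1 - tau) a)). split; [split|].
      * apply C_convex; auto. lra.
      * exists (bsub (bscal 2 e) (q z)). split; [|split].
        -- apply subspace_sub; [exact V_subspace|now apply V_subspace|now apply q_in_V with N].
        -- now rewrite bnorm_sub_sym.
        -- rewrite q_affine, HthS. fold t. rewrite Hve at 1. unfold tau.
           vec_with ltac:(field; lra).
      * replace (bsub (badd (bscal tau z) (bscal (1 - tau) a)) a) with (bscal tau (bsub z a)) by vec.
        rewrite bnorm_scal_pos by lra.
        pose proof (bnorm_sub z a). pose proof (C_bound _ _ Ha). pose proof (C_bound _ _ Hz).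
        pose proof (bnorm_ge0 (bsub z a)).
        apply Rle_trans with (t * bnorm (bsub z a)); [nra|]. apply Rmult_le_compat_l; lra.
  - destruct (telescoping_cauchy u (fun n => th n * (4 * INR N))) as [a Ha].
    + intros n. specialize (Hth n). nra.
    + intros eps He. destruct (half_pow_small (4 * INR N) eps He) as [k Hk]. exists k.
      unfold th. lra.
    + intros n. destruct (Hu n) as [_ H]. rewrite HthS. lra.
    + exists a. split.
      * apply (C_closed N). intros eps He.
        destruct (half_pow_small (4 * INR N) eps He) as [k Hk].
        exists (u k). destruct (Hu k) as [[H _] _]. split; [exact H|].
        rewrite bnorm_sub_sym. specialize (Ha k). unfold th in Ha. lra.
      * apply bnorm_sub_eq. intros eps He.
        set (B := L * (4 * INR N) + (rho / 2 + (bnorm (q z0) + L * (2 * INR N)))).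
        destruct (half_pow_small B eps He) as [k Hk].
        destruct (Hu k) as [[H1 (e & HeV & Her & Hve)] _]. specialize (Ha k).
        pose proof (q_lipschitz a (u k)) as Hq.
        pose proof (bnorm_sub_le (q a) (q (u k)) v) as Ht.
        assert (Hqv : bnorm (bsub (q (u k)) v) <= th k * (rho / 2 + (bnorm (q z0) + L * (2 * INR N)))).
        { replace (bsub (q (u k)) v) with (bscal (th k) (bsub (q (u k)) e)).
          - specialize (Hth k). rewrite bnorm_scal_pos by lra. apply Rmult_le_compat_l; [lra|].
            pose proof (bnorm_sub (q (u k)) e). pose proof (bnorm_le_sub (q (u k)) (q z0)).
            pose proof (q_lipschitz (u k) z0). pose proof (bnorm_sub (u k) z0).
            pose proof (C_bound _ _ H1). pose proof (C_bound _ _ Hz0).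
            assert (L * bnorm (bsub (u k) z0) <= L * (2 * INR N)) by (apply Rmult_le_compat_l; lra).
            lra.
          - rewrite Hve. vec. }
        assert (L * bnorm (bsub a (u k)) <= L * (th k * (4 * INR N))) by (apply Rmult_le_compat_l; lra).
        fold (th k) in Hk. unfold B in Hk. lra.
Qed.

End ConvexOpenMapping.

(** * Duality for A^* T A under the constraint qualification *)

Lemma nonneg_of_small_error (a c : R) : (forall e, 0 < e < 1 -> 0 <= a + e * c) -> 0 <= a.
Proof.
  intros H. apply Rnot_lt_le. intros Ha. pose proof (Rabs_pos c). pose proof (Rle_abs c).
  assert (Hd : 0 < 2 * (Rabs c - a + 1)) by lra.
  set (e := - a / (2 * (Rabs c - a + 1))).
  assert (He1 : 0 < e) by (apply Rdiv_lt_0_compat; lra).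
  assert (He : e * (2 * (Rabs c - a + 1)) = - a) by (unfold e; field; lra).
  assert (He2 : e < 1) by nra.
  specialize (H e (conj He1 He2)). nra.
Qed.

Lemma dual_bounded_above_0 {E : BanachSpace} (a : E -> R) (c : R) :
  is_dual a -> (forall x, a x <= c) -> forall x, a x = 0.
Proof.
  intros Ha H x. apply NNPP. intros Hn. specialize (H (bscal ((c + 1) / a x) x)).
  rewrite dual_scal in H by exact Ha.
  replace ((c + 1) / a x * a x) with (c + 1) in H by (field; exact Hn). lra.
Qed.

Lemma dual_space_sub_le {E : BanachSpace} (f g : dual_space E) r :
  dual_bound r (fun u => proj1_sig f u - proj1_sig g u) -> bnorm (bsub f g) <= r.
Proof.
  intros H. apply dual_norm_least. simpl.
  replace (fun u => proj1_sig f u + -1 * proj1_sig g u)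
    with (fun u => proj1_sig f u - proj1_sig g u); [exact H|].
  apply functional_extensionality; intros u; ring.
Qed.

Lemma dual_space_sub_bound {E : BanachSpace} (f g : dual_space E) :
  dual_bound (bnorm (bsub f g)) (fun u => proj1_sig f u - proj1_sig g u).
Proof.
  pose proof (dual_norm_bound (bsub f g : dual_car E)) as H. simpl in H.
  replace (fun u => proj1_sig f u - proj1_sig g u)
    with (fun u => proj1_sig f u + -1 * proj1_sig g u); [exact H|].
  apply functional_extensionality; intros u; ring.
Qed.

(* Total extension, by [0] off the dual, of a functional on the dual space. *)
Definition bidual_of {E : BanachSpace} (G : dual_space E -> R) (f : E -> R) : R :=
  match excluded_middle_informative (is_dual f) with
  | left H => G (dual_mk f H)
  | right _ => 0
  end.

Lemma bidual_of_mk {E : BanachSpace} (G : dual_space E -> R) f (H : is_dual f) :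
  bidual_of G f = G (dual_mk f H).
Proof.
  unfold bidual_of. destruct excluded_middle_informative as [H'|H']; [|easy].
  apply (f_equal G). now apply dual_car_ext.
Qed.

Lemma is_bidual_of {E : BanachSpace} (G : dual_space E -> R) :
  is_dual G -> is_bidual (bidual_of G).
Proof.
  intros HG. split; [|split].
  - intros f g Hf Hg. rewrite (bidual_of_mk G f Hf), (bidual_of_mk G g Hg).
    rewrite (bidual_of_mk G _ (is_dual_add f g Hf Hg)).
    rewrite <- (dual_add G) by exact HG. apply (f_equal G). now apply dual_car_ext.
  - intros t f Hf. rewrite (bidual_of_mk G f Hf), (bidual_of_mk G _ (is_dual_scal t f Hf)).
    rewrite <- (dual_scal G) by exact HG. apply (f_equal G). now apply dual_car_ext.
  - destruct (dual_has_bound G HG) as [M [HM0 HM]]. exists M. intros f r Hf Hr.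
    rewrite (bidual_of_mk G f Hf). apply Rle_trans with (1 := HM _).
    apply Rmult_le_compat_l; [exact HM0|]. exact (dual_norm_least (dual_mk f Hf) r Hr).
Qed.

Section LinearMaps.
Context {X Y : BanachSpace} (A : X -> Y) (A_lin : lin_cont A).

Lemma lin_add x y : A (badd x y) = badd (A x) (A y).
Proof. apply A_lin. Qed.

Lemma lin_scal t x : A (bscal t x) = bscal t (A x).
Proof. apply A_lin. Qed.

Lemma lin_sub x y : A (bsub x y) = bsub (A x) (A y).
Proof. unfold bsub. now rewrite !bopp_scal, lin_add, lin_scal. Qed.

Lemma lin_0 : A bzero = bzero.
Proof. now rewrite <- (bscal_0l bzero), lin_scal, bscal_0l. Qed.

Lemma lin_bound : exists M, 0 <= M /\ forall x, bnorm (A x) <= M * bnorm x.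
Proof.
  destruct A_lin as (_ & _ & M & HM). exists (Rmax 0 M). split; [apply Rmax_l|].
  intros x. apply Rle_trans with (1 := HM x).
  apply Rmult_le_compat_r; [apply bnorm_ge0|apply Rmax_r].
Qed.

Lemma dual_bound_pull M r f :
  0 <= M -> (forall x, bnorm (A x) <= M * bnorm x) ->
  dual_bound r f -> dual_bound (r * M) (fun u => f (A u)).
Proof.
  intros HM0 HM [Hr0 Hr]. split; [now apply Rmult_le_pos|].
  intros x. specialize (Hr (A x)). specialize (HM x). nra.
Qed.

Lemma is_dual_pull f : is_dual f -> is_dual (fun u => f (A u)).
Proof.
  intros Hf. destruct (dual_has_bound f Hf) as [r Hr]. destruct lin_bound as (M & HM0 & HM).
  apply is_dual_intro with (r * M).
  - intros x y. now rewrite lin_add, dual_add.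
  - intros t x. now rewrite lin_scal, dual_scal.
  - now apply dual_bound_pull.
Qed.

Lemma is_bidual_pull phi : is_bidual phi -> is_bidual (fun f : Y -> R => phi (fun u : X => f (A u))).
Proof.
  intros H. split; [|split].
  - intros f g Hf Hg. apply bidual_add; [exact H| |]; now apply is_dual_pull.
  - intros t f Hf. apply bidual_scal; [exact H|]; now apply is_dual_pull.
  - destruct (bidual_bound phi H) as (M & HM0 & HM). destruct lin_bound as (N & HN0 & HN).
    exists (M * N). intros f r Hf Hr. rewrite Rmult_assoc, (Rmult_comm N).
    apply HM; [now apply is_dual_pull|now apply dual_bound_pull].
Qed.

End LinearMaps.

(** * Equivalent norms and the weighted norms used for type (D) *)

Record equiv_norm {E : BanachSpace} (p : E -> R) (c1 c2 : R) : Prop := {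
  en_pos1 : 0 < c1;
  en_pos2 : 0 <= c2;
  en_lower : forall u, c1 * bnorm u <= p u;
  en_upper : forall u, p u <= c2 * bnorm u;
  en_add : forall u v, p (badd u v) <= p u + p v;
  en_scal : forall t u, p (bscal t u) = Rabs t * p u
}.

Lemma equiv_norm_bnorm (E : BanachSpace) : equiv_norm (@bnorm E) 1 1.
Proof.
  constructor; try lra; intros; try lra; [apply bnorm_triangle|apply bnorm_scal].
Qed.

Lemma equiv_norm_ge0 {E : BanachSpace} (p : E -> R) c1 c2 u : equiv_norm p c1 c2 -> 0 <= p u.
Proof.
  intros H. pose proof (en_lower _ _ _ H u). pose proof (en_pos1 _ _ _ H).
  pose proof (bnorm_ge0 u). nra.
Qed.

Lemma bnorm_le_equiv {E : BanachSpace} (p : E -> R) c1 c2 u : equiv_norm p c1 c2 -> bnorm u <= / c1 * p u.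
Proof.
  intros H. pose proof (en_lower _ _ _ H u). pose proof (en_pos1 _ _ _ H).
  apply Rmult_le_reg_l with c1; [lra|]. rewrite <- Rmult_assoc, Rinv_r by lra. lra.
Qed.

(* The conjugate of [p^2/2] is half the square of the dual norm; [q] bounds that norm from above. *)
Lemma half_square_conjugate {E : BanachSpace} (p : E -> R) c1 c2 (a : E -> R) (m : R) :
  equiv_norm p c1 c2 -> is_dual a -> 0 < m ->
  exists q u, 0 <= q /\ (forall v, Rabs (a v) <= q * p v) /\ p u ^ 2 / 2 + q ^ 2 / 2 < a u + m.
Proof.
  intros Hp Ha Hm.
  destruct (least_bound p a) as (q & Hq0 & Hq & Hleast).
  - destruct (dual_has_bound a Ha) as [r [Hr0 Hr]]. exists (r * / c1).
    pose proof (Rinv_0_lt_compat _ (en_pos1 _ _ _ Hp)) as Hc. split; [nra|].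
    intros u. apply Rle_trans with (1 := Hr u). rewrite Rmult_assoc.
    apply Rmult_le_compat_l; [exact Hr0|]. now apply bnorm_le_equiv with c2.
  - intros u. now apply equiv_norm_ge0 with c1 c2.
  - apply NNPP. intros Hn.
    assert (H : forall u, a u + m <= p u ^ 2 / 2 + q ^ 2 / 2).
    { intros u. apply Rnot_lt_le. intros Hlt. apply Hn. now exists q, u. }
    clear Hn.
    destruct (Req_dec q 0) as [Hq1|Hq1].
    + specialize (H bzero). rewrite dual_0 in H by exact Ha.
      pose proof (en_upper _ _ _ Hp bzero) as H0. rewrite bnorm_0 in H0.
      pose proof (equiv_norm_ge0 p c1 c2 bzero Hp). subst q. nra.
    (* Rescaling [u] to [p]-length [q] in the negated claim would improve the least constant [q] to
       [q - m / q]. *)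
    + assert (Hqm : 0 < m / q) by (apply Rdiv_lt_0_compat; lra).
      assert (Hone : forall u, a u <= (q - m / q) * p u).
      { intros u. destruct (Req_dec (p u) 0) as [H0|H0].
        - specialize (Hq u). rewrite H0 in *. pose proof (Rle_abs (a u)). lra.
        - pose proof (equiv_norm_ge0 p c1 c2 u Hp) as Hu.
          specialize (H (bscal (q / p u) u)).
          rewrite dual_scal, (en_scal _ _ _ Hp), Rabs_right in H
            by (try exact Ha; apply Rle_ge; left; apply Rdiv_lt_0_compat; lra).
          replace (q / p u * p u) with q in H by (field; exact H0).
          apply Rmult_le_reg_l with (q / p u); [apply Rdiv_lt_0_compat; lra|].
          replace (q / p u * ((q - m / q) * p u)) with (q ^ 2 - m) by (field; lra). lra. }
      pose proof (Hleast (Rmax 0 (q - m / q)) (Rmax_l _ _)) as Hl.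
      assert (q <= Rmax 0 (q - m / q)).
      { apply Hl. intros u. pose proof (equiv_norm_ge0 p c1 c2 u Hp) as Hu.
        apply Rle_trans with ((q - m / q) * p u).
        - apply Rabs_le. split; [|apply Hone].
          pose proof (Hone (bscal (-1) u)) as H1.
          rewrite dual_scal, (en_scal _ _ _ Hp), (Rabs_left (-1)) in H1 by (try exact Ha; lra). lra.
        - apply Rmult_le_compat_r; [exact Hu|apply Rmax_r]. }
      unfold Rmax in H0. destruct (Rle_dec 0 (q - m / q)); lra.
Qed.

Section AbsSum.
Context {E : BanachSpace}.
Implicit Types (l : list (E -> R)) (u v : E).

Definition abs_sum l u : R := fold_right (fun f acc => Rabs (f u) + acc) 0 l.

Lemma abs_sum_ge0 l u : 0 <= abs_sum l u.
Proof. induction l as [|f l IH]; simpl; [lra|]. pose proof (Rabs_pos (f u)). lra. Qed.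

Lemma abs_sum_in l f u : In f l -> Rabs (f u) <= abs_sum l u.
Proof.
  induction l as [|k l IH]; simpl; [easy|]. pose proof (Rabs_pos (k u)).
  pose proof (abs_sum_ge0 l u). intros [->|H1]; [lra|]. specialize (IH H1). lra.
Qed.

Lemma abs_sum_ker l u : ker_all l u -> abs_sum l u = 0.
Proof.
  unfold ker_all. induction l as [|k l IH]; simpl; [easy|]. intros H.
  rewrite H, IH, Rabs_R0 by auto. lra.
Qed.

Lemma abs_sum_add l u v : (forall f, In f l -> is_dual f) ->
  abs_sum l (badd u v) <= abs_sum l u + abs_sum l v.
Proof.
  induction l as [|k l IH]; simpl; intros H; [lra|].
  rewrite (dual_add k) by auto. specialize (IH ltac:(auto)). pose proof (Rabs_triang (k u) (k v)). lra.
Qed.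

Lemma abs_sum_scal l t u : (forall f, In f l -> is_dual f) ->
  abs_sum l (bscal t u) = Rabs t * abs_sum l u.
Proof.
  induction l as [|k l IH]; simpl; intros H; [lra|].
  rewrite (dual_scal k), Rabs_mult, IH by auto. ring.
Qed.

Lemma abs_sum_bound l : (forall f, In f l -> is_dual f) ->
  exists L, 0 <= L /\ forall u, abs_sum l u <= L * bnorm u.
Proof.
  induction l as [|k l IH]; simpl; intros H.
  - exists 0. split; [lra|]. intros u. lra.
  - destruct IH as (L & HL0 & HL); [auto|].
    destruct (dual_has_bound k (H k (or_introl eq_refl))) as (r & Hr0 & Hr).
    exists (r + L). split; [lra|]. intros u. specialize (HL u). specialize (Hr u). lra.
Qed.

End AbsSum.

(* Convexity along the segment: [c (t p + (1 - t) q) = t c p + (1 - t) c q - t (1 - t) c (p - q)]. *)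
Lemma convex_above_coupling {E : BanachSpace} (h : EFun E) : convex_fun h ->
  (forall y f r, is_dual f -> h y f = Fin r -> f y <= r) ->
  forall y f r y' f' r' t, is_dual f -> is_dual f' -> h y f = Fin r -> h y' f' = Fin r' -> 0 <= t <= 1 ->
  0 <= t * (1 - t) * (f (bsub y y') - f' (bsub y y')) + t * (r - f y) + (1 - t) * (r' - f' y').
Proof.
  intros h_convex h_ge y f r y' f' r' t Hf Hf' Hd Hd' Ht.
  destruct (h_convex _ _ _ _ _ _ t Hf Hf' Hd Hd' Ht) as (r2 & Hr & Hle).
  apply h_ge in Hr; [|apply is_dual_add; now apply is_dual_scal].
  rewrite !dual_add, !dual_scal in Hr by assumption. rewrite !dual_sub by assumption. nra.
Qed.

Section Precomposition.
Context {X Y : BanachSpace} (T : Op Y) (h : EFun Y) (A : X -> Y) (b : Y) (V : Y -> Prop) (M delta : R).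
Hypothesis T_maximal : maximal_monotone T.
Hypothesis h_convex : convex_fun h.
Hypothesis h_ge : forall y f r, is_dual f -> h y f = Fin r -> f y <= r.
Hypothesis h_T : forall y f, T y f -> h y f = Fin (f y).
Hypothesis h_strong : strong_rep h.
Hypothesis A_lin : lin_cont A.
Hypothesis V_subspace : subspace V.
Hypothesis h_in_V : forall z f r x, is_dual f -> h z f = Fin r -> V (bsub z (badd (A x) b)).
Hypothesis delta_pos : 0 < delta.
(* The constraint qualification in quantitative form, as provided by [convex_open_mapping]. *)
Hypothesis h_ball : forall v, V v -> bnorm v < delta ->
  exists z f r x, is_dual f /\ h z f = Fin r /\ r <= M /\ bnorm x <= M /\ dual_bound M f /\
    v = bsub z (badd (A x) b).

(** The shift [bzero] gives [A^* T A]; a general [b] is kept because any point of this graph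
    exhibits [b] as an element of [D(T) - im A]. *)
Definition precomp : Op X := fun x s => exists f, T (badd (A x) b) f /\ forall u, s u = f (A u).

(** [d] is the excess of [h] over the coupling; as a relation it only speaks of finite values of
    [h]. *)
Definition h_gap (x : X) (f : Y -> R) (d : R) : Prop :=
  is_dual f /\ h (badd (A x) b) f = Fin (d + f (badd (A x) b)).

Lemma h_gap_ge0 x f d : h_gap x f d -> 0 <= d.
Proof. intros [Hf Hd]. apply h_ge in Hd; [lra|exact Hf]. Qed.

Lemma precomp_gap x s : precomp x s -> exists f, h_gap x f 0 /\ forall u, s u = f (A u).
Proof.
  intros (f & Hf & Hs). exists f. split; [split|exact Hs].
  - now apply T_maximal in Hf.
  - rewrite (h_T _ _ Hf). f_equal. ring.
Qed.

Lemma precomp_dual x s : precomp x s -> is_dual s.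
Proof.
  intros (f & Hf & Hs). replace s with (fun u => f (A u)).
  - apply is_dual_pull; [exact A_lin|]. now apply T_maximal in Hf.
  - apply functional_extensionality; intros u; now rewrite Hs.
Qed.

Lemma shift_sub x x' : bsub (badd (A x) b) (badd (A x') b) = A (bsub x x').
Proof. rewrite (lin_sub A A_lin). vec. Qed.

Lemma h_gap_pair x f d x' f' d' t : h_gap x f d -> h_gap x' f' d' -> 0 <= t <= 1 ->
  0 <= t * (1 - t) * (f (A (bsub x x')) - f' (A (bsub x x'))) + t * d + (1 - t) * d'.
Proof.
  intros [Hf Hd] [Hf' Hd'] Ht.
  pose proof (convex_above_coupling h h_convex h_ge _ _ _ _ _ _ t Hf Hf' Hd Hd' Ht) as H.
  rewrite shift_sub in H. lra.
Qed.

(* Fenchel duality with the penalty left out: the dual variable itself lies in [T (A x0 + b)]. *)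
Lemma precomp_of_dual_bound x0 s : is_dual s ->
  (forall x f d, h_gap x f d -> 0 <= s (bsub x0 x) - f (A (bsub x0 x)) + d) -> precomp x0 s.
Proof.
  intros Hs Hpos.
  destruct (dual_has_bound s Hs) as [sb [Hsb0 Hsb]].
  destruct (subgradient_at_0
    (fun v r => exists z f rho x, is_dual f /\ h z f = Fin rho /\ v = bsub z (badd (A x) b) /\
       rho - f (badd (A x0) b) - s x + s x0 <= r) V
    (M + M * bnorm (badd (A x0) b) + sb * M + Rabs (s x0)) delta 0) as (f0 & Hf0 & Hsub).
  - intros v r w q t (z & f & rho & x & Hf & Hrho & -> & Hr)
      (z' & f' & rho' & x' & Hf' & Hrho' & -> & Hr') Ht.
    destruct (h_convex _ _ _ _ _ _ t Hf Hf' Hrho Hrho' Ht) as (r2 & Hr2 & Hle).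
    exists (badd (bscal t z) (bscal (1 - t) z')), (fun u => t * f u + (1 - t) * f' u), r2,
      (badd (bscal t x) (bscal (1 - t) x')).
    split; [apply is_dual_add; now apply is_dual_scal|split; [exact Hr2|split]].
    + rewrite (lin_add A A_lin), !(lin_scal A A_lin). vec.
    + rewrite (dual_add s), !(dual_scal s) by exact Hs. nra.
  - exact V_subspace.
  - intros v r (z & f & rho & x & Hf & Hrho & -> & _). now apply h_in_V with f rho.
  - exact delta_pos.
  - intros v Hv Hvd. destruct (h_ball v Hv Hvd) as (z & f & r & x & Hf & Hr & HrM & Hx & [HM0 Hfb] & Hveq).
    exists (r - f (badd (A x0) b) - s x + s x0). split.
    + specialize (Hfb (badd (A x0) b)). specialize (Hsb x).
      pose proof (Rle_abs (s x0)). pose proof (Rle_abs (- s x)). rewrite Rabs_Ropp in H0.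
      pose proof (Rle_abs (- f (badd (A x0) b))). rewrite Rabs_Ropp in H1.
      assert (sb * bnorm x <= sb * M) by (apply Rmult_le_compat_l; lra). lra.
    + exists z, f, r, x. split; [exact Hf|split; [exact Hr|split; [exact Hveq|lra]]].
  - intros r (z & f & rho & x & Hf & Hrho & Hz & Hr).
    symmetry in Hz. apply bsub_eq0 in Hz. subst z.
    specialize (Hpos x f (rho - f (badd (A x) b))).
    rewrite <- shift_sub in Hpos. rewrite !dual_sub in Hpos by assumption.
    assert (h_gap x f (rho - f (badd (A x) b))).
    { split; [exact Hf|]. rewrite Hrho. f_equal. ring. }
    specialize (Hpos H). lra.
  (* As [x] is free here, the linear functional [s - A^* f0] is bounded above, hence zero; at
     [x = 0] the inequality then says that [f0] at [A x0 + b] is monotonically related to [T]. *)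
  - assert (Hle : forall z f rho x, is_dual f -> h z f = Fin rho ->
        f0 z - f0 (A x) - f0 b <= rho - f (badd (A x0) b) - s x + s x0).
    { intros z f rho x Hf Hrho.
      enough (f0 (bsub z (badd (A x) b)) + 0 <= rho - f (badd (A x0) b) - s x + s x0) as H.
      { rewrite dual_sub, dual_add in H by exact Hf0. lra. }
      apply Hsub. exists z, f, rho, x. split; [exact Hf|split; [exact Hrho|split; [easy|lra]]]. }
    assert (Hsf : forall x, s x = f0 (A x)).
    { destruct (h_ball bzero) as (z & f & r & x1 & Hf & Hr & _).
      - apply V_subspace.
      - rewrite bnorm_0. exact delta_pos.
      - intros x.
        pose proof (dual_bounded_above_0 (fun u => s u - f0 (A u))
          (r - f (badd (A x0) b) + s x0 - f0 z + f0 b)) as H.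
        enough (s x - f0 (A x) = 0) by lra. apply H.
        + apply is_dual_sub; [exact Hs|]. now apply is_dual_pull.
        + intros u. specialize (Hle z f r u Hf Hr). lra. }
    exists f0. split; [|exact Hsf].
    apply T_maximal; [exact Hf0|]. intros z f Hzf.
    assert (Hf : is_dual f) by (now apply T_maximal in Hzf).
    specialize (Hle z f (f z) bzero Hf (h_T _ _ Hzf)).
    rewrite (lin_0 A A_lin), dual_0, dual_0, Hsf in Hle by assumption.
    rewrite !dual_sub, !dual_add by assumption. rewrite dual_add in Hle by assumption. lra.
Qed.

(** Convexity along the segment to an arbitrary [h_gap x' f' d'] gives in the limit
    [0 <= t (1 - t) c0 + (1 - t) d'], where [s] has replaced the approximating pullbacks. Dividing
    by [1 - t] and letting [t] tend to [1] yields the hypothesis of [precomp_of_dual_bound]. *)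
Lemma precomp_closed x0 s : is_dual s ->
  (forall eps, 0 < eps -> exists x f d, h_gap x f d /\ d <= eps /\ bnorm (bsub x x0) <= eps /\
     dual_bound eps (fun u => f (A u) - s u)) -> precomp x0 s.
Proof.
  intros Hs Happ. apply precomp_of_dual_bound; [exact Hs|]. intros x' f' d' Hg'.
  pose proof (h_gap_ge0 _ _ _ Hg') as Hd'.
  assert (Hf' : is_dual f') by apply Hg'.
  pose proof (is_dual_pull A A_lin f' Hf') as Hp'.
  destruct (dual_has_bound s Hs) as [sb [Hsb0 Hsb]].
  destruct (dual_has_bound _ Hp') as [fb [Hfb0 Hfb]].
  set (c0 := s (bsub x0 x') - f' (A (bsub x0 x'))).
  assert (Ht : forall t, 0 < t < 1 -> 0 <= t * c0 + d').
  { intros t Ht.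
    enough (0 <= t * (1 - t) * c0 + (1 - t) * d').
    { apply Rmult_le_reg_l with (1 - t); [lra|]. lra. }
    apply nonneg_of_small_error with (sb + fb + bnorm (bsub x0 x') + 2).
    intros e He. destruct (Happ e) as (x & f & d & Hg & Hd & Hx & [_ Hfe]); [lra|].
    pose proof (h_gap_pair _ _ _ _ _ _ t Hg Hg' ltac:(lra)) as H.
    assert (Hf : is_dual f) by apply Hg.
    pose proof (is_dual_pull A A_lin f Hf) as Hp.
    assert (Hc : f (A (bsub x x')) - f' (A (bsub x x')) <= c0 + e * (sb + fb + bnorm (bsub x0 x') + 1)).
    { specialize (Hfe (bsub x x')). specialize (Hsb (bsub x x0)). specialize (Hfb (bsub x x0)).
      pose proof (Rle_abs (f (A (bsub x x')) - s (bsub x x'))).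
      pose proof (Rle_abs (s (bsub x x0))). pose proof (Rle_abs (- f' (A (bsub x x0)))).
      rewrite Rabs_Ropp in H2. unfold c0.
      pose proof (bnorm_sub_le x x0 x').
      rewrite !(lin_sub A A_lin) in *. rewrite !dual_sub in * by assumption.
      assert (sb * bnorm (bsub x x0) <= sb * e) by (apply Rmult_le_compat_l; lra).
      assert (fb * bnorm (bsub x x0) <= fb * e) by (apply Rmult_le_compat_l; lra).
      assert (e * bnorm (bsub x x') <= e * (1 + bnorm (bsub x0 x'))) by (apply Rmult_le_compat_l; lra).
      lra. }
    assert (Htt : 0 < t * (1 - t) <= 1) by nra.
    apply (Rmult_le_compat_l (t * (1 - t))) in Hc; [|lra].
    assert (t * d <= 1 * e).
    { apply Rmult_le_compat; try lra. now apply h_gap_ge0 with x f. }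
    pose proof (bnorm_ge0 (bsub x0 x')).
    assert (t * (1 - t) * (e * (sb + fb + bnorm (bsub x0 x') + 1)) <= 1 * (e * (sb + fb + bnorm (bsub x0 x') + 1))).
    { apply Rmult_le_compat_r; [|lra]. apply Rmult_le_pos; lra. }
    lra. }
  apply nonneg_of_small_error with (- c0). intros e He.
  specialize (Ht (1 - e) ltac:(lra)). unfold c0 in *. lra.
Qed.

(* Fenchel duality: the perturbation of [A x + b = z] has subgradient [f0] by the constraint
   qualification, that of the second penalty is a bidual element [psi], and strength of [h] is
   applied at [f0] and [A x0 + b] minus the pullback of [psi]. *)
Lemma penalized_infimum (p : X -> R) c1 c2 x0 g m :
  equiv_norm p c1 c2 -> is_dual g -> 0 < m ->
  exists x f d P Q, h_gap x f d /\ p (bsub x x0) <= P /\ 0 <= Q /\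
    (forall u, Rabs (f (A u) - g u) <= Q * p u) /\
    d + (f (A (bsub x x0)) - g (bsub x x0)) + P ^ 2 / 2 + Q ^ 2 / 2 < m.
Proof.
  intros Hp Hg Hm. apply NNPP. intros Hno.
  destruct (dual_has_bound g Hg) as [gb [Hgb0 Hgb]].
  destruct (lin_bound A A_lin) as (N & HN0 & HN).
  pose proof (en_pos1 _ _ _ Hp) as Hc1. pose proof (en_pos2 _ _ _ Hp) as Hc2.
  pose proof (Rinv_0_lt_compat _ Hc1) as Hic1.
  (* [P0] and [Q0] bound the two penalties wherever [h_ball] supplies data: [M N + delta + gb]
     bounds the norm of [A^* f + w - g] for a perturbation [w] of norm below [delta]. *)
  set (Q0 := (M * N + delta + gb) * / c1).
  set (P0 := c2 * (M + bnorm x0)).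
  (* [P] and [Q] dominate the two norms instead of equalling them, which makes the relation convex.
     Only the first component of a perturbation is confined to [V]; the second ranges over the whole
     dual of [X]. *)
  destruct (@subgradient_at_0 (prod_space Y (dual_space X))
    (fun v r => exists z f rho x P Q, is_dual f /\ h z f = Fin rho /\ p (bsub x x0) <= P /\ 0 <= Q /\
       (forall u, Rabs (f (A u) + proj1_sig (snd v) u - g u) <= Q * p u) /\
       fst v = bsub z (badd (A x) b) /\
       rho - f (badd (A x0) b) - g x + g x0 + P ^ 2 / 2 + Q ^ 2 / 2 <= r)
    (fun v => V (fst v))
    (M + M * bnorm (badd (A x0) b) + gb * M + Rabs (g x0) + P0 ^ 2 / 2 + Q0 ^ 2 / 2) delta m)
    as (F & HF & Hsub).
  - intros v r w q t (z & f & rho & x & P & Q & Hf & Hrho & HP & HQ & HfQ & Hv & Hr)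
      (z' & f' & rho' & x' & P' & Q' & Hf' & Hrho' & HP' & HQ' & HfQ' & Hv' & Hr') Ht.
    destruct (h_convex _ _ _ _ _ _ t Hf Hf' Hrho Hrho' Ht) as (r2 & Hr2 & Hle).
    exists (badd (bscal t z) (bscal (1 - t) z')), (fun u => t * f u + (1 - t) * f' u), r2,
      (badd (bscal t x) (bscal (1 - t) x')), (t * P + (1 - t) * P'), (t * Q + (1 - t) * Q').
    split; [apply is_dual_add; now apply is_dual_scal|split; [exact Hr2|]].
    split; [|split; [nra|split; [|split]]].
    + replace (bsub (badd (bscal t x) (bscal (1 - t) x')) x0)
        with (badd (bscal t (bsub x x0)) (bscal (1 - t) (bsub x' x0))) by vec.
      apply Rle_trans with (1 := en_add _ _ _ Hp _ _).
      rewrite !(en_scal _ _ _ Hp), !Rabs_right by lra. nra.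
    + intros u. specialize (HfQ u). specialize (HfQ' u).
      replace (t * f (A u) + (1 - t) * f' (A u) +
               proj1_sig (snd (badd (bscal t v) (bscal (1 - t) w))) u - g u)
        with (t * (f (A u) + proj1_sig (snd v) u - g u) +
              (1 - t) * (f' (A u) + proj1_sig (snd w) u - g u))
        by (destruct v, w; simpl; ring).
      apply Rle_trans with (1 := Rabs_triang _ _).
      rewrite !Rabs_mult, (Rabs_right t), (Rabs_right (1 - t)) by lra. nra.
    + destruct v as [v1 v2], w as [w1 w2]. simpl in *. rewrite Hv, Hv', (lin_add A A_lin), !(lin_scal A A_lin). vec.
    + rewrite (dual_add g), !(dual_scal g) by exact Hg.
      assert ((t * P + (1 - t) * P') ^ 2 <= t * P ^ 2 + (1 - t) * P' ^ 2).
      { enough (0 <= t * (1 - t) * (P - P') ^ 2) by lra.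
        apply Rmult_le_pos; [nra|apply pow2_ge_0]. }
      assert ((t * Q + (1 - t) * Q') ^ 2 <= t * Q ^ 2 + (1 - t) * Q' ^ 2).
      { enough (0 <= t * (1 - t) * (Q - Q') ^ 2) by lra.
        apply Rmult_le_pos; [nra|apply pow2_ge_0]. }
      nra.
  - split; [apply V_subspace|split].
    + intros v w Hv Hw. now apply V_subspace.
    + intros t v Hv. now apply V_subspace.
  - intros v r (z & f & rho & x & P & Q & Hf & Hrho & _ & _ & _ & -> & _). now apply h_in_V with f rho.
  - exact delta_pos.
  - intros [y w] Hv Hvd. simpl in Hv, Hvd.
    pose proof (dual_norm_ge0 w) as Hw0. pose proof (bnorm_ge0 y) as Hy0.
    destruct (h_ball y Hv) as (z & f & r & x & Hf & Hr & HrM & Hx & HfM & Hy); [lra|].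
    pose proof HfM as [HM0 Hfb].
    exists (r - f (badd (A x0) b) - g x + g x0 + P0 ^ 2 / 2 + Q0 ^ 2 / 2). split.
    + specialize (Hfb (badd (A x0) b)). specialize (Hgb x).
      pose proof (Rle_abs (g x0)). pose proof (Rle_abs (- g x)). rewrite Rabs_Ropp in H0.
      pose proof (Rle_abs (- f (badd (A x0) b))). rewrite Rabs_Ropp in H1.
      assert (gb * bnorm x <= gb * M) by (apply Rmult_le_compat_l; lra). lra.
    + exists z, f, r, x, P0, Q0. split; [exact Hf|split; [exact Hr|]].
      assert (HQ0 : 0 <= M * N + delta + gb) by nra.
      split; [|split; [unfold Q0; nra|split; [|split; [exact Hy|lra]]]].
      * apply Rle_trans with (1 := en_upper _ _ _ Hp _). unfold P0.
        apply Rmult_le_compat_l; [lra|]. pose proof (bnorm_sub x x0). lra.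
      * intros u. simpl.
        pose proof (dual_bound_pull A N M f HN0 HN HfM) as [_ Hfu].
        pose proof (dual_norm_bound w) as [_ Hwu].
        specialize (Hfu u). specialize (Hwu u). specialize (Hgb u).
        pose proof (bnorm_ge0 u). pose proof (bnorm_le_equiv p c1 c2 u Hp).
        apply Rle_trans with ((M * N + delta + gb) * bnorm u).
        -- pose proof (Rabs_triang (f (A u) + proj1_sig w u) (- g u)).
           pose proof (Rabs_triang (f (A u)) (proj1_sig w u)). rewrite Rabs_Ropp in H1.
           unfold Rminus. assert (dual_norm w * bnorm u <= delta * bnorm u) by (apply Rmult_le_compat_r; lra).
           lra.
        -- unfold Q0. rewrite Rmult_assoc. apply Rmult_le_compat_l; lra.
  - intros r (z & f & rho & x & P & Q & Hf & Hrho & HP & HQ & HfQ & Hz & Hr).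
    simpl in Hz. symmetry in Hz. apply bsub_eq0 in Hz. subst z.
    apply Rnot_lt_le. intros Hlt. apply Hno.
    exists x, f, (rho - f (badd (A x) b)), P, Q.
    split; [split; [exact Hf|rewrite Hrho; f_equal; ring]|].
    split; [exact HP|split; [exact HQ|split]].
    + intros u. specialize (HfQ u). simpl in HfQ. now rewrite Rplus_0_r in HfQ.
    + rewrite <- shift_sub. rewrite !dual_sub by assumption. lra.
  - set (f0 := fun y : Y => F (y, bzero)).
    set (G := fun w : dual_space X => F (bzero, w)).
    set (psi := bidual_of G).
    assert (HF2 : forall y w, F (y, w) = f0 y + G w).
    { intros y w. unfold f0, G. rewrite <- (dual_add F) by exact HF. f_equal.
      unfold badd at 1; cbn [prod_space fst snd]. f_equal; vec. }
    assert (Hf0 : is_dual f0).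
    { destruct (dual_has_bound F HF) as [r [Hr0 Hr]]. apply is_dual_intro with r.
      - intros y y'. unfold f0. rewrite <- (dual_add F) by exact HF. f_equal.
        unfold badd at 2; cbn [prod_space fst snd]. f_equal; vec.
      - intros t y. unfold f0. rewrite <- (dual_scal F) by exact HF. f_equal.
        unfold bscal at 2; cbn [prod_space fst snd]. f_equal; vec.
      - split; [exact Hr0|]. intros y. specialize (Hr (y, bzero)). cbn [prod_space bnorm fst snd] in Hr.
        fold (@bnorm (dual_space X)) in Hr. rewrite (@bnorm_0 (dual_space X)) in Hr. now rewrite Rplus_0_r in Hr. }
    assert (HG : is_dual G).
    { destruct (dual_has_bound F HF) as [r [Hr0 Hr]]. apply is_dual_intro with r.
      - intros y y'. unfold G. rewrite <- (dual_add F) by exact HF. f_equal.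
        unfold badd at 2; cbn [prod_space fst snd]. f_equal; vec.
      - intros t y. unfold G. rewrite <- (dual_scal F) by exact HF. f_equal.
        unfold bscal at 2; cbn [prod_space fst snd]. f_equal; vec.
      - split; [exact Hr0|]. intros y. specialize (Hr (bzero, y)). cbn [prod_space bnorm fst snd] in Hr.
        fold (@bnorm Y) in Hr. rewrite (@bnorm_0 Y) in Hr. now rewrite Rplus_0_l in Hr. }
    pose proof (is_bidual_of G HG) as Hpsi. fold psi in Hpsi.
    set (a := fun u => g u - f0 (A u)).
    assert (Hf0A : is_dual (fun u => f0 (A u))) by (now apply is_dual_pull).
    assert (Ha : is_dual a) by (now apply is_dual_sub).
    (* [m] is split in half: one half is the error in the conjugate of the penalty at
       [a = g - A^* f0], the other the error in the supremum of strength. At [x = x0 + u] the two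
       strict estimates contradict the subgradient inequality. *)
    destruct (half_square_conjugate p c1 c2 a (m / 2) Hp Ha) as (Q & u & HQ0 & HQ & HQu); [lra|].
    pose proof (bidual_eval_shift _ (-1) (badd (A x0) b) (is_bidual_pull A A_lin psi Hpsi)) as Hphi.
    destruct (h_strong f0 _ Hf0 Hphi
      (f0 (badd (A x0) b) + -1 * psi (fun u => f0 (A u)) - m / 2)) as (z & f & rho & Hf & Hrho & Hlt); [lra|].
    assert (HfA : is_dual (fun u => f (A u))) by (now apply is_dual_pull).
    (* the value [w = g - A^*f - a] of the second perturbation *)
    assert (Hw : is_dual (fun u => g u - f (A u) - a u)) by (apply is_dual_sub; [now apply is_dual_sub|exact Ha]).
    pose proof (Hsub (bsub z (badd (A (badd x0 u)) b), dual_mk _ Hw)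
      (rho - f (badd (A x0) b) - g (badd x0 u) + g x0 + p u ^ 2 / 2 + Q ^ 2 / 2)) as HK.
    assert (Hval : F (bsub z (badd (A (badd x0 u)) b), dual_mk _ Hw) + m <=
        rho - f (badd (A x0) b) - g (badd x0 u) + g x0 + p u ^ 2 / 2 + Q ^ 2 / 2).
    { apply HK. exists z, f, rho, (badd x0 u), (p u), Q.
      split; [exact Hf|split; [exact Hrho|split; [|split; [exact HQ0|split; [|split; [easy|lra]]]]]].
      - right. f_equal. vec.
      - intros v. specialize (HQ v). simpl.
        replace (f (A v) + (g v - f (A v) - a v) - g v) with (- a v) by ring. now rewrite Rabs_Ropp. }
    rewrite HF2, <- (bidual_of_mk G _ Hw) in Hval. fold psi in Hval.
    rewrite (bidual_sub psi (fun u => g u - f (A u)) a) in Hval by auto using is_dual_sub.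
    rewrite (bidual_sub psi g (fun u => f (A u))) in Hval by auto.
    unfold a in Hval at 1. rewrite (bidual_sub psi g (fun u => f0 (A u))) in Hval by auto.
    rewrite dual_sub, dual_add, (lin_add A A_lin), (dual_add f0 (A x0)) in Hval by assumption.
    rewrite (dual_add g) in Hval by exact Hg.
    unfold a in HQu. rewrite (dual_add f0 (A x0) b) in Hlt by exact Hf0. lra.
Qed.

(** Penalize around [x] and [A^* f]. The cross term satisfies [c >= - Q P], which gives the new gap;
    convexity at the midpoint gives [c >= -2 (d + d')], hence [P^2 + Q^2 <= 5 tau^2], which the
    radius [3 * tau] covers. *)
Lemma gap_improvement x f d tau : 0 < tau -> h_gap x f d -> d <= tau ^ 2 ->
  exists x' f' d', h_gap x' f' d' /\ d' <= (tau / 2) ^ 2 /\ bnorm (bsub x' x) <= 3 * tau /\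
    dual_bound (3 * tau) (fun u => f' (A u) - f (A u)).
Proof.
  intros Htau Hg Hd.
  assert (Hf : is_dual f) by apply Hg.
  pose proof (is_dual_pull A A_lin f Hf) as HfA.
  destruct (penalized_infimum bnorm 1 1 x (fun u => f (A u)) ((tau / 2) ^ 2) (equiv_norm_bnorm X) HfA)
    as (x' & f' & d' & P & Q & Hg' & HP & HQ & HfQ & Hlt); [nra|].
  exists x', f', d'.
  pose proof (h_gap_ge0 _ _ _ Hg') as Hd'.
  pose proof (h_gap_pair _ _ _ _ _ _ (/ 2) Hg' Hg ltac:(lra)) as Hpair.
  pose proof (bnorm_ge0 (bsub x' x)) as Hn.
  pose proof (HfQ (bsub x' x)) as HQx. cbv beta in HQx, Hlt.
  set (c := f' (A (bsub x' x)) - f (A (bsub x' x))) in *.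
  assert (Hc : - (Q * P) <= c).
  { pose proof (Rle_abs (- c)). rewrite Rabs_Ropp in H.
    assert (Q * bnorm (bsub x' x) <= Q * P) by (apply Rmult_le_compat_l; lra). lra. }
  assert (HPQ : 0 <= (P - Q) ^ 2) by apply pow2_ge_0.
  assert (Hd2 : d' <= (tau / 2) ^ 2) by nra.
  assert (Hsum : P ^ 2 + Q ^ 2 <= (3 * tau) ^ 2) by nra.
  assert (P <= 3 * tau) by (pose proof (pow2_ge_0 Q); nra).
  assert (Q <= 3 * tau) by (pose proof (pow2_ge_0 P); nra).
  split; [exact Hg'|split; [exact Hd2|split; [lra|split; [lra|]]]].
  intros u. apply Rle_trans with (1 := HfQ u).
  apply Rmult_le_compat_r; [apply bnorm_ge0|lra].
Qed.

(* A Broendsted-Rockafellar property. *)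
Lemma precomp_near_gap x f d tau : 0 < tau -> h_gap x f d -> d <= tau ^ 2 ->
  exists x' s', precomp x' s' /\ bnorm (bsub x' x) <= 6 * tau /\
    dual_bound (6 * tau) (fun u => s' u - f (A u)).
Proof.
  intros Htau Hg Hd.
  set (th := fun n => tau * (/ 2) ^ n).
  assert (Hth : forall n, 0 < th n) by (intros n; apply Rmult_lt_0_compat; [lra|apply pow_lt; lra]).
  assert (HthS : forall n, th (S n) = th n / 2) by (intros n; unfold th; simpl; lra).
  assert (HF : is_dual f) by apply Hg.
  (* Keeping the gap below [th n ^ 2] makes each step at most [3 * th n], and these sum to at most
     [6 * tau]. *)
  destruct (dependent_choice_nat (X * dual_car Y)
    (fun n a => exists d, h_gap (fst a) (proj1_sig (snd a)) d /\ d <= th n ^ 2)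
    (fun n a a' => bnorm (bsub (fst a') (fst a)) <= 3 * th n /\
       dual_bound (3 * th n) (fun u => proj1_sig (snd a') (A u) - proj1_sig (snd a) (A u)))
    (x, dual_mk f HF)) as (w & Hw0 & Hw).
  - exists d. simpl. split; [exact Hg|]. unfold th. simpl. nra.
  - intros n [y k] (dn & Hgn & Hdn). cbn [fst snd] in *.
    destruct (gap_improvement _ _ _ (th n) (Hth n) Hgn Hdn) as (y' & k' & d' & Hg' & Hd' & H1 & H2).
    exists (y', dual_mk k' (proj1 Hg')). split; [|split; [exact H1|exact H2]].
    exists d'. split; [exact Hg'|]. now rewrite HthS.
  - assert (Hsmall : forall eps, 0 < eps -> exists N, 6 * th N < eps).
    { intros eps He. destruct (half_pow_small (6 * tau) eps He) as [N HN]. exists N. unfold th. lra. }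
    set (pull := fun k : dual_car Y => dual_mk _ (is_dual_pull A A_lin _ (proj2_sig k)) : dual_space X).
    destruct (telescoping_cauchy (fun n => fst (w n)) (fun n => 6 * th n)) as [l Hl].
    + intros n. specialize (Hth n). lra.
    + exact Hsmall.
    + intros n. rewrite HthS. destruct (Hw n) as [_ [H _]]. lra.
    + destruct (telescoping_cauchy (fun n => pull (snd (w n))) (fun n => 6 * th n)) as [s Hs].
      * intros n. specialize (Hth n). lra.
      * exact Hsmall.
      * intros n. rewrite HthS. destruct (Hw n) as [_ [_ H]].
        apply Rle_trans with (3 * th n); [|lra]. now apply dual_space_sub_le.
      * assert (Hsb : forall n, dual_bound (6 * th n)
            (fun u => proj1_sig s u - proj1_sig (snd (w n)) (A u))).
        { intros n. apply dual_bound_le with (1 := Hs n). apply (dual_space_sub_bound s (pull (snd (w n)))). }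
        exists l, (proj1_sig s). split; [|split].
        -- apply precomp_closed; [apply proj2_sig|]. intros eps He.
           destruct (Hsmall (Rmin eps 1)) as [N HN]; [apply Rmin_pos; lra|].
           pose proof (Rmin_l eps 1). pose proof (Rmin_r eps 1).
           destruct (Hw N) as [(dN & HgN & HdN) _]. specialize (Hth N).
           exists (fst (w N)), (proj1_sig (snd (w N))), dN. split; [exact HgN|split; [nra|split]].
           ++ rewrite bnorm_sub_sym. specialize (Hl N). lra.
           ++ split; [lra|]. intros u. destruct (Hsb N) as [_ Hu]. specialize (Hu u).
              rewrite Rabs_minus_sym. pose proof (bnorm_ge0 u). nra.
        -- specialize (Hl O). rewrite Hw0 in Hl. unfold th in Hl. simpl in Hl. lra.
        -- specialize (Hsb O). rewrite Hw0 in Hsb. apply dual_bound_le with (2 := Hsb).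
           unfold th. simpl. lra.
Qed.

(** An almost minimizer of the penalized problem is moved to a true graph point. The move costs at
    most [e = eta / 2] in [p] and in its dual norm; since the penalties are quadratic, the error
    grows linearly in [P] and [Q]. *)
Lemma precomp_almost_minimizer (p : X -> R) c1 c2 x0 g eta :
  equiv_norm p c1 c2 -> is_dual g -> 0 < eta <= 1 ->
  exists x s P Q, precomp x s /\ p (bsub x x0) <= P /\ 0 <= Q /\
    (forall u, Rabs (s u - g u) <= Q * p u) /\
    (s (bsub x x0) - g (bsub x x0)) + P ^ 2 / 2 + Q ^ 2 / 2 <= eta * (1 + P + Q).
Proof.
  intros Hp Hg Heta.
  pose proof (en_pos1 _ _ _ Hp) as Hc1. pose proof (en_pos2 _ _ _ Hp) as Hc2.
  pose proof (Rinv_0_lt_compat _ Hc1) as Hic1.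
  (* [D] turns a displacement [6 * tau] in the original norms into at most [eta / 2], through [c2]
     for [p] and [/ c1] for its dual norm. *)
  set (D := 1 + 12 * c2 + 12 * / c1).
  assert (HD : 1 <= D) by (unfold D; lra).
  set (tau := eta / D).
  assert (HtD : tau * D = eta) by (unfold tau; field; lra).
  assert (Htau : 0 < tau) by (apply Rdiv_lt_0_compat; lra).
  assert (Htau1 : tau <= eta) by nra.
  assert (Hb2 : 6 * tau * c2 <= eta / 2) by (unfold D in HtD; nra).
  assert (Hb1 : 6 * tau * / c1 <= eta / 2) by (unfold D in HtD; nra).
  destruct (penalized_infimum p c1 c2 x0 g (tau ^ 2) Hp Hg) as
    (x1 & f1 & d1 & P1 & Q1 & Hg1 & HP1 & HQ1 & HfQ1 & Hlt); [nra|].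
  pose proof (h_gap_ge0 _ _ _ Hg1) as Hd1.
  assert (Hf1 : is_dual f1) by apply Hg1.
  pose proof (is_dual_pull A A_lin f1 Hf1) as HfA.
  pose proof (equiv_norm_ge0 p c1 c2 (bsub x1 x0) Hp) as Hp1.
  set (cc := f1 (A (bsub x1 x0)) - g (bsub x1 x0)) in *.
  assert (Hcc : - (Q1 * P1) <= cc).
  { pose proof (HfQ1 (bsub x1 x0)) as H. fold cc in H. pose proof (Rle_abs (- cc)).
    rewrite Rabs_Ropp in H0.
    assert (Q1 * p (bsub x1 x0) <= Q1 * P1) by (apply Rmult_le_compat_l; lra). lra. }
  assert (HPQ : 0 <= (P1 - Q1) ^ 2) by apply pow2_ge_0.
  assert (Hd1t : d1 <= tau ^ 2) by nra.
  destruct (precomp_near_gap x1 f1 d1 tau Htau Hg1 Hd1t) as (x & s & HS & Hx & [_ Hs]).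
  set (e := eta / 2) in *.
  assert (Hpx : p (bsub x x1) <= e).
  { apply Rle_trans with (1 := en_upper _ _ _ Hp _). nra. }
  assert (Hps : forall u, Rabs (s u - f1 (A u)) <= e * p u).
  { intros u. apply Rle_trans with (1 := Hs u).
    pose proof (bnorm_le_equiv p c1 c2 u Hp). pose proof (equiv_norm_ge0 p c1 c2 u Hp).
    apply Rle_trans with (6 * tau * (/ c1 * p u)); [apply Rmult_le_compat_l; lra|].
    rewrite <- Rmult_assoc. apply Rmult_le_compat_r; lra. }
  assert (Hpx0 : p (bsub x x0) <= P1 + e).
  { replace (bsub x x0) with (badd (bsub x1 x0) (bsub x x1)) by vec.
    pose proof (en_add _ _ _ Hp (bsub x1 x0) (bsub x x1)). lra. }
  exists x, s, (P1 + e), (Q1 + e).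
  split; [exact HS|split; [exact Hpx0|split; [unfold e; lra|split]]].
  - intros u. pose proof (Rabs_triang (s u - f1 (A u)) (f1 (A u) - g u)).
    replace (s u - f1 (A u) + (f1 (A u) - g u)) with (s u - g u) in H by ring.
    specialize (Hps u). specialize (HfQ1 u). lra.
  - pose proof (precomp_dual x s HS) as HsD.
    assert (Hdec : s (bsub x x0) - g (bsub x x0) =
      cc + (f1 (A (bsub x x1)) - g (bsub x x1)) + (s (bsub x x0) - f1 (A (bsub x x0)))).
    { unfold cc. rewrite !(lin_sub A A_lin). rewrite !dual_sub by assumption. ring. }
    pose proof (HfQ1 (bsub x x1)) as H1. pose proof (Hps (bsub x x0)) as H2.
    pose proof (Rle_abs (f1 (A (bsub x x1)) - g (bsub x x1))).
    pose proof (Rle_abs (s (bsub x x0) - f1 (A (bsub x x0)))).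
    assert (He : 0 < e) by (unfold e; lra).
    assert (Q1 * p (bsub x x1) <= Q1 * e) by (apply Rmult_le_compat_l; lra).
    assert (e * p (bsub x x0) <= e * (P1 + e)) by (apply Rmult_le_compat_l; lra).
    assert (tau ^ 2 <= eta) by nra.
    replace eta with (2 * e) in * by (unfold e; field). nra.
Qed.

(** Completing the squares in the previous estimate. [K] is [0] for a point monotonically related to
    the graph, and a scaled norm bound of a bidual element in the type (D) argument. *)
Lemma precomp_coercive_minimizer (p : X -> R) c1 c2 x0 g K eta :
  equiv_norm p c1 c2 -> is_dual g -> 0 < eta <= 1 ->
  (forall x s Q, precomp x s -> 0 <= Q -> (forall u, Rabs (s u - g u) <= Q * p u) ->
     - (K * Q) <= s (bsub x x0) - g (bsub x x0)) ->
  exists x s P Q, precomp x s /\ p (bsub x x0) <= P /\ 0 <= Q /\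
    (forall u, Rabs (s u - g u) <= Q * p u) /\
    (P - eta) ^ 2 + (Q - K - eta) ^ 2 <= 2 * eta + eta ^ 2 + (K + eta) ^ 2.
Proof.
  intros Hp Hg Heta HK.
  destruct (precomp_almost_minimizer p c1 c2 x0 g eta Hp Hg Heta)
    as (x & s & P & Q & HS & HP & HQ & Hs & Hle).
  exists x, s, P, Q. split; [exact HS|split; [exact HP|split; [exact HQ|split; [exact Hs|]]]].
  specialize (HK x s Q HS HQ Hs). nra.
Qed.

(** * Maximality, nonempty domain and type (D) *)

Lemma precomp_monotone : monotone precomp.
Proof.
  split; [apply precomp_dual|].
  intros x s x' s' (f & Hf & Hs) (f' & Hf' & Hs').
  rewrite Hs, Hs', <- shift_sub. now apply (proj2 (proj1 T_maximal)).
Qed.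

Lemma precomp_maximal : maximal_monotone precomp.
Proof.
  split; [exact precomp_monotone|]. intros x0 g Hg Hrel.
  apply precomp_closed; [exact Hg|]. intros eps0 He0.
  set (eps := Rmin eps0 1).
  assert (He : 0 < eps <= 1) by (split; [apply Rmin_pos; lra|apply Rmin_r]).
  assert (Hee : eps <= eps0) by apply Rmin_l.
  (* With [K = 0] the two squares sum to at most [4 * eta], which for [eta = eps ^ 2 / 16] is
     [(eps / 2) ^ 2]. *)
  destruct (precomp_coercive_minimizer bnorm 1 1 x0 g 0 (eps ^ 2 / 16) (equiv_norm_bnorm X) Hg)
    as (x & s & P & Q & HS & HP & HQ & Hs & Hle); [nra| |].
  - intros x s Q HS _ _. specialize (Hrel x s HS).
    pose proof (precomp_dual x s HS) as HsD. rewrite !dual_sub in * by assumption. lra.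
  - pose proof (bnorm_ge0 (bsub x x0)) as Hn.
    set (eta := eps ^ 2 / 16) in *.
    assert (Heta : 0 < eta <= eps / 16) by (unfold eta; nra).
    assert (Hsq : (P - eta) ^ 2 + (Q - 0 - eta) ^ 2 <= (eps / 2) ^ 2).
    { apply Rle_trans with (1 := Hle). replace ((eps / 2) ^ 2) with (4 * eta) by (unfold eta; field). nra. }
    assert (HP2 : P <= eps).
    { pose proof (pow2_ge_0 (Q - 0 - eta)). apply Rnot_lt_le. intros Hlt. nra. }
    assert (HQ2 : Q <= eps).
    { pose proof (pow2_ge_0 (P - eta)). apply Rnot_lt_le. intros Hlt. nra. }
    destruct (precomp_gap x s HS) as (f & Hf & Hsf).
    exists x, f, 0. split; [exact Hf|split; [lra|split; [lra|split; [lra|]]]].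
    intros u. rewrite <- Hsf. apply Rle_trans with (1 := Hs u).
    apply Rmult_le_compat_r; [apply bnorm_ge0|lra].
Qed.

Lemma precomp_nonempty : exists x s, precomp x s.
Proof.
  destruct (precomp_almost_minimizer bnorm 1 1 bzero (fun _ => 0) 1 (equiv_norm_bnorm X) is_dual_zero)
    as (x & s & P & Q & HS & _); [lra|]. now exists x, s.
Qed.

(* The norm weighs the finitely many directions [l] heavily, yet on bidual elements vanishing on
   [l], such as [phi - x0] with [x0] from Helly's theorem, its dual is the original bidual norm. *)
Lemma precomp_closure_approx phi g :
  gossez_closure precomp phi g ->
  exists B, forall (l : list (X -> R)) eps, (forall f, In f l -> is_dual f) -> 0 < eps ->
    exists x s, precomp x s /\ bnorm x <= B /\ (forall f, In f l -> Rabs (f x - phi f) <= eps) /\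
      dual_bound eps (fun u => s u - g u).
Proof.
  intros (Hphi & Hg & Hrel).
  destruct (bidual_bound phi Hphi) as (Mphi & HM0 & HM).
  set (K := 2 * Mphi + 1).
  exists (Mphi + 1 + (K + 4)). intros l eps Hl He.
  destruct (helly phi Mphi l Hphi HM Hl) as (x0 & Hx0 & Hfx0).
  pose (psi := fun f : X -> R => phi f - f x0).
  assert (Hpsi : is_bidual psi) by (now apply bidual_minus_eval).
  assert (HpsiK : forall f r, is_dual f -> dual_bound r f -> Rabs (psi f) <= K * r).
  { intros f r Hf Hr. specialize (HM f r Hf Hr). destruct Hr as [Hr0 Hr]. specialize (Hr x0).
    unfold psi, Rminus. pose proof (Rabs_triang (phi f) (- f x0)). rewrite Rabs_Ropp in H.
    unfold K. assert (r * bnorm x0 <= r * (Mphi + 1)) by (apply Rmult_le_compat_l; lra). lra. }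
  (* [K + 4] is the bound obtained below for [|x - x0| + N sum |f_j (x - x0)|], so this [N] makes
     each [|f_j (x - x0)|] at most [eps]. [lam] is chosen after it, small against [C], which depends
     on [N]. *)
  set (N := (K + 4) / eps).
  assert (HK : 1 <= K) by (unfold K; lra).
  assert (HN : 0 < N) by (apply Rdiv_lt_0_compat; lra).
  destruct (abs_sum_bound l Hl) as (L & HL0 & HL).
  set (C := 1 + N * L).
  assert (HC : 1 <= C) by (unfold C; nra).
  set (lam := Rmin 1 (eps / ((2 * K + 4) * C))).
  assert (HKC : 0 < (2 * K + 4) * C) by nra.
  assert (Hlam : 0 < lam <= 1).
  { split; [|apply Rmin_l]. apply Rmin_pos; [lra|now apply Rdiv_lt_0_compat]. }
  assert (HlamC : lam * ((2 * K + 4) * C) <= eps).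
  { replace eps with (eps / ((2 * K + 4) * C) * ((2 * K + 4) * C)) by (field; nra).
    apply Rmult_le_compat_r; [lra|apply Rmin_r]. }
  set (p := fun u : X => lam * (bnorm u + N * abs_sum l u)).
  assert (HpC : forall u, p u <= lam * C * bnorm u).
  { intros u. unfold p, C. rewrite Rmult_assoc. apply Rmult_le_compat_l; [lra|].
    specialize (HL u). nra. }
  assert (Hp : equiv_norm p lam (lam * C)).
  { constructor; [lra|nra| |exact HpC| |].
    - intros u. unfold p. apply Rmult_le_compat_l; [lra|]. pose proof (abs_sum_ge0 l u). nra.
    - intros u v. unfold p. pose proof (bnorm_triangle _ u v). pose proof (abs_sum_add l u v Hl) as Hs.
      apply (Rmult_le_compat_l N) in Hs; [|lra].
      rewrite <- Rmult_plus_distr_l. apply Rmult_le_compat_l; lra.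
    - intros t u. unfold p. rewrite bnorm_scal, abs_sum_scal by exact Hl. ring. }
  destruct (precomp_coercive_minimizer p lam (lam * C) x0 g (lam * K) (lam ^ 2) Hp Hg)
    as (x & s & P & Q & HS & HP & HQ & Hs & Hle); [nra| |].
  - intros x s Q HS HQ Hs.
    pose proof (precomp_dual x s HS) as HsD.
    assert (HwD : is_dual (fun u => s u - g u)) by (now apply is_dual_sub).
    set (w := fun u => s u - g u) in *.
    (* On the kernel of [l] the norm [p] is [lam |.|], so [w] restricted there extends to [w0] of
       norm at most [Q * lam]. As [psi] does not distinguish [w] from [w0], the weight [N]
       disappears from the estimate. *)
    destruct (mazur_orlicz (fun v r => ker_all l v /\ r = w v) (Q * lam)) as (w0 & Hw0 & Hw0b & Hw0w).
    + nra.
    + intros v r v' r' t [Hv ->] [Hv' ->] Ht. split.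
      * pose proof (subspace_ker_all l Hl) as Hk. apply Hk; now apply Hk.
      * rewrite (dual_add w), !(dual_scal w) by exact HwD. reflexivity.
    + intros v r [Hv ->]. specialize (Hs v). change (s v - g v) with (w v) in Hs.
      unfold p in Hs. rewrite (abs_sum_ker l v Hv) in Hs.
      pose proof (Rle_abs (- w v)). rewrite Rabs_Ropp in H. lra.
    + assert (Hker : psi (fun u => w u - w0 u) = 0).
      { apply (bidual_ker_all psi l); [exact Hpsi| |now apply is_dual_sub|].
        - intros f Hf. split; [now apply Hl|]. unfold psi. rewrite (Hfx0 f Hf). ring.
        - intros v Hv.
          pose proof (Hw0w v (w v) (conj Hv eq_refl)).
          pose proof (Hw0w (bopp v) (w (bopp v))) as H2.
          rewrite !dual_opp in H2 by assumption.
          specialize (H2 (conj (subspace_opp _ v (subspace_ker_all l Hl) Hv) eq_refl)). lra. }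
      rewrite bidual_sub in Hker by assumption.
      pose proof (HpsiK w0 (Q * lam) Hw0 Hw0b) as Hb.
      specialize (Hrel x s HS).
      replace (fun u : X => g u - s u) with (fun u : X => -1 * w u) in Hrel
        by (apply functional_extensionality; intros u; unfold w; ring).
      rewrite bidual_scal in Hrel by assumption.
      pose proof (Rle_abs (- psi w0)) as Hab. rewrite Rabs_Ropp in Hab.
      assert (Hpw : psi w = phi w - w x0) by reflexivity.
      change (s (bsub x x0) - g (bsub x x0)) with (w (bsub x x0)).
      rewrite (dual_sub w) by exact HwD.
      assert (w x = s x - g x) by reflexivity. lra.
  (* [P] is at most [lam (K + 4)], and dividing by [lam] gives bounds free of [lam]; [Q] keeps a
     factor [lam], which makes the dual error at most [eps]. *)
  - assert (HQP : (P - lam ^ 2) ^ 2 + (Q - lam * K - lam ^ 2) ^ 2 <= (lam * (K + 3)) ^ 2).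
    { apply Rle_trans with (1 := Hle).
      assert (lam ^ 2 <= lam) by nra.
      assert (lam ^ 2 * lam ^ 2 <= lam ^ 2) by nra.
      assert (lam * lam ^ 2 <= lam ^ 2) by nra. nra. }
    assert (Hl2 : lam ^ 2 <= lam) by nra.
    assert (Hl3 : 0 <= lam * (K + 3)) by nra.
    assert (HPle : P <= lam * (K + 4)).
    { enough (P - lam ^ 2 <= lam * (K + 3)) by lra.
      pose proof (pow2_ge_0 (Q - lam * K - lam ^ 2)). apply Rnot_lt_le. intros Hlt. nra. }
    assert (HQle : Q <= lam * (2 * K + 4)).
    { enough (Q - lam * K - lam ^ 2 <= lam * (K + 3)) by lra.
      pose proof (pow2_ge_0 (P - lam ^ 2)). apply Rnot_lt_le. intros Hlt. nra. }
    assert (Hn : bnorm (bsub x x0) + N * abs_sum l (bsub x x0) <= K + 4).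
    { apply Rmult_le_reg_l with lam; [lra|]. unfold p in HP. lra. }
    pose proof (bnorm_ge0 (bsub x x0)). pose proof (abs_sum_ge0 l (bsub x x0)).
    exists x, s. split; [exact HS|split; [|split; [|split; [lra|]]]].
    + pose proof (bnorm_le_sub x x0). nra.
    + intros f Hf. rewrite <- (Hfx0 f Hf), <- dual_sub by (now apply Hl).
      apply Rle_trans with (1 := abs_sum_in l f _ Hf).
      apply Rmult_le_reg_l with N; [exact HN|].
      replace (N * eps) with (K + 4) by (unfold N; field; lra). lra.
    + intros u. apply Rle_trans with (1 := Hs u).
      pose proof (bnorm_ge0 u).
      apply Rle_trans with (lam * (2 * K + 4) * (lam * C * bnorm u)).
      * apply Rmult_le_compat; [exact HQ|now apply equiv_norm_ge0 with lam (lam * C)|exact HQle|apply HpC].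
      * replace (lam * (2 * K + 4) * (lam * C * bnorm u)) with (lam * (lam * ((2 * K + 4) * C)) * bnorm u) by ring.
        apply Rmult_le_compat_r; [lra|]. nra.
Qed.

(** The net is indexed by finite lists of functionals under inclusion together with a tolerance
    index; boundedness comes from the one [B] that serves all lists and tolerances. *)
Theorem precomp_typeD : gossez_typeD precomp.
Proof.
  split; [exact precomp_maximal|]. intros phi g Hcl.
  destruct (precomp_closure_approx phi g Hcl) as [B HB].
  pose (I := (list (dual_car X) * nat)%type).
  assert (Hpos : forall n, 0 < / (INR n + 1)) by (intros n; apply Rinv_0_lt_compat; pose proof (pos_INR n); lra).
  assert (Hch : forall i : I, exists q : X * (X -> R), precomp (fst q) (snd q) /\ bnorm (fst q) <= B /\
     (forall f, In f (fst i) -> Rabs (proj1_sig f (fst q) - phi (proj1_sig f)) <= / (INR (snd i) + 1)) /\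
     dual_bound (/ (INR (snd i) + 1)) (fun u => snd q u - g u)).
  { intros [l n]. destruct (HB (map (@proj1_sig _ _) l) (/ (INR n + 1))) as (x & s & H1 & H2 & H3 & H4).
    - intros f Hf. apply in_map_iff in Hf. destruct Hf as (k & <- & _). apply proj2_sig.
    - apply Hpos.
    - exists (x, s). split; [exact H1|split; [exact H2|split; [|exact H4]]].
      intros f Hf. apply H3. now apply in_map. }
  pose (q := fun i => proj1_sig (constructive_indefinite_description _ (Hch i))).
  assert (Hq : forall i, precomp (fst (q i)) (snd (q i)) /\ bnorm (fst (q i)) <= B /\
     (forall f, In f (fst i) -> Rabs (proj1_sig f (fst (q i)) - phi (proj1_sig f)) <= / (INR (snd i) + 1)) /\
     dual_bound (/ (INR (snd i) + 1)) (fun u => snd (q i) u - g u))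
    by (intros i; exact (proj2_sig (constructive_indefinite_description _ (Hch i)))).
  clearbody q.
  assert (Harch : forall eps, 0 < eps -> exists N, forall n, (N <= n)%nat -> / (INR n + 1) < eps).
  { intros eps He. destruct (INR_unbounded (/ eps)) as [N HN]. exists N. intros n Hn.
    apply le_INR in Hn. pose proof (Rinv_0_lt_compat _ He).
    rewrite <- (Rinv_inv eps). apply Rinv_lt_contravar; [|lra].
    apply Rmult_lt_0_compat; lra. }
  exists I, (fun i j => incl (fst i) (fst j) /\ (snd i <= snd j)%nat),
    (fun i => fst (q i)), (fun i => snd (q i)).
  split; [exact (inhabits (nil, O))|].
  split; [intros i; split; [apply incl_refl|lia]|].
  split; [intros i j k [H1 H2] [H3 H4]; split; [now apply incl_tran with (fst j)|lia]|].
  split.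
  { intros [l n] [l' n']. exists (l ++ l', max n n'). simpl.
    split; split; try lia; [apply incl_appl|apply incl_appr]; apply incl_refl. }
  split; [intros i; apply Hq|].
  split; [|split].
  - destruct Hcl as (_ & Hg & _). destruct (dual_has_bound g Hg) as [r Hr].
    exists (Rmax B (r + 1)). intros i. destruct (Hq i) as (_ & H1 & _ & H2). split.
    + apply Rle_trans with (1 := H1). apply Rmax_l.
    + apply dual_bound_le with (r + 1); [apply Rmax_r|].
      replace (snd (q i)) with (fun u => g u + (snd (q i) u - g u))
        by (apply functional_extensionality; intros u; ring).
      apply dual_bound_add; [exact Hr|]. apply dual_bound_le with (2 := H2).
      rewrite <- Rinv_1. apply Rinv_le_contravar; [lra|]. pose proof (pos_INR (snd i)). lra.
  - intros f Hf eps He. destruct (Harch eps He) as [N HN].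
    exists (dual_mk f Hf :: nil, N). intros i [Hi Hn]. simpl in Hi, Hn.
    destruct (Hq i) as (_ & _ & H & _).
    apply Rle_lt_trans with (/ (INR (snd i) + 1)); [|now apply HN].
    apply (H (dual_mk f Hf)). apply Hi. now left.
  - intros eps He. destruct (Harch eps He) as [N HN]. exists (nil, N). intros i [_ Hn]. simpl in Hn.
    destruct (Hq i) as (_ & _ & _ & H). apply dual_bound_le with (2 := H). left. now apply HN.
Qed.

End Precomposition.

(** * Affine hulls and the six domains *)

Section AffineHulls.
Context {E : BanachSpace}.
Implicit Types (C D S : set E) (u v x y : E).

Lemma sub_aff D x : D x -> aff D x.
Proof. intros H C _ HC. now apply HC. Qed.

Lemma affine_aff D : affine_set (aff D).
Proof. intros x y t Hx Hy C HC HD. apply HC; [now apply Hx|now apply Hy]. Qed.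

Lemma aff_le D C : affine_set C -> (forall x, D x -> C x) -> forall x, aff D x -> C x.
Proof. intros HC HD x Hx. now apply Hx. Qed.

Lemma aff_mono D S : (forall x, D x -> S x) -> forall x, aff D x -> aff S x.
Proof. intros H. apply aff_le; [apply affine_aff|]. intros x Hx. now apply sub_aff, H. Qed.

Definition direction C u : set E := fun v => C (badd u v).

Lemma direction_sub C u x : C x -> direction C u (bsub x u).
Proof. intros H. unfold direction. now replace (badd u (bsub x u)) with x by vec. Qed.

Lemma subspace_direction C u : affine_set C -> C u -> subspace (direction C u).
Proof.
  intros HC Hu.
  assert (Hscal : forall t v, direction C u v -> direction C u (bscal t v)).
  { intros t v Hv. unfold direction.
    replace (badd u (bscal t v)) with (badd (bscal t (badd u v)) (bscal (1 - t) u)) by vec.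
    now apply HC. }
  split; [|split; [|exact Hscal]].
  - unfold direction. now replace (badd u bzero) with u by vec.
  - intros v w Hv Hw.
    replace (badd v w) with (bscal 2 (badd (bscal (/ 2) v) (bscal (1 - / 2) w))) by vecf.
    apply Hscal. unfold direction.
    replace (badd u (badd (bscal (/ 2) v) (bscal (1 - / 2) w)))
      with (badd (bscal (/ 2) (badd u v)) (bscal (1 - / 2) (badd u w))) by vec.
    now apply HC.
Qed.

Lemma closed_direction C u : closed_set C -> closed_set (direction C u).
Proof.
  intros HC v Hv. apply HC. intros eps He. destruct (Hv eps He) as (z & Hz & Hzv).
  exists (badd u z). split; [exact Hz|]. now replace (bsub (badd u z) (badd u v)) with (bsub z v) by vec.
Qed.

Lemma closed_set_iff C D : (forall x, C x <-> D x) -> closed_set C -> closed_set D.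
Proof.
  intros H HC y Hy. apply H, HC. intros eps He. destruct (Hy eps He) as (z & Hz & Hzy).
  exists z. split; [now apply H|exact Hzy].
Qed.

(** With [set_minus_direction] this identifies [aff (D - D)], over which [icr] quantifies, with the
    direction space of [aff D]. One endpoint is varied at a time. *)
Lemma aff_set_minus D a c : aff D a -> aff D c -> aff (set_minus D D) (bsub a c).
Proof.
  intros Ha Hc.
  assert (H1 : forall d, D d -> aff (set_minus D D) (bsub a d)).
  { intros d Hd. revert a Ha.
    apply (aff_le D (fun a => aff (set_minus D D) (bsub a d))).
    - intros x y t Hx Hy.
      replace (bsub (badd (bscal t x) (bscal (1 - t) y)) d)
        with (badd (bscal t (bsub x d)) (bscal (1 - t) (bsub y d))) by vec.
      now apply affine_aff.
    - intros x Hx. apply sub_aff. now exists x, d. }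
  revert c Hc. apply (aff_le D (fun c => aff (set_minus D D) (bsub a c))); [|exact H1].
  intros x y t Hx Hy.
  replace (bsub a (badd (bscal t x) (bscal (1 - t) y)))
    with (badd (bscal t (bsub a x)) (bscal (1 - t) (bsub a y))) by vec.
  now apply affine_aff.
Qed.

Lemma set_minus_direction D u x : aff D u -> aff (set_minus D D) x -> direction (aff D) u x.
Proof.
  intros Hu. pose proof (subspace_direction _ u (affine_aff D) Hu) as HW.
  apply (aff_le (set_minus D D) (direction (aff D) u)).
  - intros y z t Hy Hz. apply HW; now apply HW.
  - intros y (a & c & Ha & Hc & ->).
    replace (bsub a c) with (bsub (bsub a u) (bsub c u)) by vec.
    apply subspace_sub; [exact HW| |]; now apply direction_sub, sub_aff.
Qed.

Lemma ri_ic D u : ri D u -> ic D u.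
Proof.
  intros (Hcl & Hu & eps & He & Hball). split; [exact Hcl|].
  intros x Hx. pose proof (bnorm_ge0 x) as Hn.
  exists (eps / (bnorm x + 1) / 2).
  assert (Hd : 0 < eps / (bnorm x + 1)) by (apply Rdiv_lt_0_compat; lra).
  split; [lra|]. intros lam Hlam. apply Hball.
  - pose proof (subspace_direction _ u (affine_aff D) (sub_aff _ _ Hu)) as HW.
    apply HW. now apply set_minus_direction; [apply sub_aff|].
  - replace (bsub (badd u (bscal lam x)) u) with (bscal lam x) by vec.
    rewrite bnorm_scal_pos by lra.
    apply Rle_lt_trans with (eps / (bnorm x + 1) / 2 * (bnorm x + 1)).
    + apply Rmult_le_compat; lra.
    + replace (eps / (bnorm x + 1) / 2 * (bnorm x + 1)) with (eps / 2) by (field; lra). lra.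
Qed.

(** [S] lies between [D] and [aff D], so both sets have the same affine hull and the same directions
    to be tested by [icr]. *)
Lemma ic_mono D S u : (forall x, D x -> S x) -> (forall x, S x -> aff D x) -> ic D u -> ic S u.
Proof.
  intros HDS HSD [Hcl Hicr]. split.
  - apply closed_set_iff with (2 := Hcl). intros x. split; [now apply aff_mono|].
    now apply aff_le; [apply affine_aff|].
  - intros x Hx. destruct (Hicr x) as (delta & Hd & H).
    + revert x Hx. apply aff_le; [apply affine_aff|].
      intros x (a & c & Ha & Hc & ->). apply aff_set_minus; now apply HSD.
    + exists delta. split; [exact Hd|]. intros lam Hlam. now apply HDS, H.
Qed.

End AffineHulls.

(** * The domains of [T] and [h] modulo the image of [A] *)

Section Domains.
Context {X Y : BanachSpace} (T : Op Y) (h : EFun Y) (A : X -> Y).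
Hypothesis T_maximal : maximal_monotone T.
Hypothesis h_rep : representative h T.
Hypothesis h_strong : strong_rep h.
Hypothesis A_lin : lin_cont A.

Let DT : set Y := set_minus (dom_op T) (image A).
Let Dh : set Y := set_minus (prY_dom h) (image A).

Lemma prY_dom_iff z : prY_dom h z <-> exists f r, is_dual f /\ h z f = Fin r.
Proof.
  split.
  - intros (f & Hf & H). destruct (h z f) as [r|] eqn:Hr; [|easy]. now exists f, r.
  - intros (f & r & Hf & Hr). exists f. split; [exact Hf|]. now rewrite Hr.
Qed.

Lemma rep_ge y f r : is_dual f -> h y f = Fin r -> f y <= r.
Proof. intros Hf Hr. destruct h_rep as (_ & _ & H & _). specialize (H y f Hf). now rewrite Hr in H. Qed.

Lemma dom_op_prY y : dom_op T y -> prY_dom h y.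
Proof.
  intros [f Hf]. exists f. split; [now apply T_maximal in Hf|].
  destruct h_rep as (_ & _ & _ & H). now rewrite (H y f Hf).
Qed.

Lemma co_dom_op_prY y : co (dom_op T) y -> prY_dom h y.
Proof.
  intros H. apply H; [|exact dom_op_prY]. intros x z t Hx Hz Ht.
  apply prY_dom_iff in Hx, Hz. destruct Hx as (f & r & Hf & Hr), Hz as (g & s & Hg & Hs).
  destruct h_rep as [Hc _]. destruct (Hc _ _ _ _ _ _ t Hf Hg Hr Hs Ht) as (q & Hq & _).
  apply prY_dom_iff. eexists _, q. split; [|exact Hq]. apply is_dual_add; now apply is_dual_scal.
Qed.

Lemma maximal_nonempty : exists y f, T y f.
Proof.
  apply NNPP. intros Hn. apply Hn. exists bzero, (fun _ => 0).
  apply T_maximal; [exact is_dual_zero|]. intros z g Hz. exfalso. apply Hn. now exists z, g.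
Qed.

(* If the domain lies in a closed affine set with direction [W], then [T + W^perp = T], so [h] stays
   finite and equal to the coupling along [W^perp]; convexity then confines its domain to the same
   affine set. *)
Lemma dom_h_in_hull (D : set Y) :
  (forall y, DT y -> D y) -> closed_set (aff D) -> forall y, Dh y -> aff D y.
Proof.
  intros HD Hcl y (z & ? & Hz & [x ->] & ->).
  destruct maximal_nonempty as (y0 & f0 & Hy0).
  destruct T_maximal as [[HTd HTm] HTmax].
  assert (Hrange : forall y1 f1 x1, T y1 f1 -> aff D (bsub y1 (A x1))).
  { intros y1 f1 x1 H1. apply sub_aff, HD. exists y1, (A x1).
    split; [now exists f1|split; [now exists x1|easy]]. }
  assert (Hy0D : aff D y0).
  { replace y0 with (bsub y0 (A bzero)) by (rewrite (lin_0 A A_lin); vec). now apply Hrange with f0. }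
  pose proof (subspace_direction _ y0 (affine_aff D) Hy0D) as HW.
  assert (HWT : forall y1 f1, T y1 f1 -> direction (aff D) y0 (bsub y1 y0)).
  { intros y1 f1 H1. apply direction_sub.
    replace y1 with (bsub y1 (A bzero)) by (rewrite (lin_0 A A_lin); vec). now apply Hrange with f1. }
  assert (HWA : direction (aff D) y0 (bopp (A x))).
  { exact (Hrange y0 f0 x Hy0). }
  assert (HWz : direction (aff D) y0 (bsub z y0)).
  { apply annihilator_closed; [exact HW|now apply closed_direction|].
    intros f Hf HfW.
    apply prY_dom_iff in Hz. destruct Hz as (k & r & Hk & Hr).
    pose proof (HTd _ _ Hy0) as Hf0.
    assert (HT : forall t, T y0 (fun u => f0 u + t * f u)).
    { intros t. apply HTmax; [apply is_dual_add; [exact Hf0|now apply is_dual_scal]|].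
      intros z' g' Hz'. pose proof (HTm _ _ _ _ Hy0 Hz').
      replace (bsub y0 z') with (bopp (bsub z' y0)) by vec.
      rewrite (dual_opp f) by exact Hf. rewrite (HfW _ (HWT _ _ Hz')).
      replace (bopp (bsub z' y0)) with (bsub y0 z') by vec. lra. }
    apply NNPP. intros Hn.
    (* With this [t] the inequality at the midpoint reduces to [0 <= - 1 / 4]. *)
    set (t := (k (bsub z y0) - f0 (bsub z y0) + 2 * (r - k z) + 1) / f (bsub z y0)).
    destruct h_rep as (h_convex & _ & _ & h_T).
    pose proof (convex_above_coupling h h_convex rep_ge z k r y0 _ _ (/ 2) Hk (HTd _ _ (HT t))
      Hr (h_T _ _ (HT t)) ltac:(lra)) as H.
    assert (Ht : t * f (bsub z y0) = k (bsub z y0) - f0 (bsub z y0) + 2 * (r - k z) + 1)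
      by (unfold t; field; exact Hn).
    cbv beta in H. lra. }
  unfold direction in HWz.
  pose proof (subspace_direction _ y0 (affine_aff D) Hy0D) as (_ & Hadd & _).
  specialize (Hadd _ _ HWz HWA). unfold direction in Hadd.
  now replace (bsub z (A x)) with (badd y0 (badd (bsub z y0) (bopp (A x)))) by vec.
Qed.

Lemma DT_Dh y : DT y -> Dh y.
Proof.
  intros (z & w & Hz & Hw & ->). exists z, w. split; [now apply dom_op_prY|now split].
Qed.

(** [icr] yields membership only through some direction. A point of the graph of [T] supplies the
    zero direction, and [lam = 0] then returns [u]. *)
Lemma Dh_in u : icr Dh u -> Dh u.
Proof.
  intros Hicr. destruct maximal_nonempty as (y & f & Hy).
  assert (Ha : aff Dh (bsub y (A bzero))).
  { apply sub_aff, DT_Dh. exists y, (A bzero). split; [now exists f|split; [now exists bzero|easy]]. }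
  destruct (Hicr (bsub (bsub y (A bzero)) (bsub y (A bzero)))) as (d & Hd & H).
  - now apply aff_set_minus.
  - specialize (H 0 ltac:(lra)).
    now match type of H with Dh ?v => replace v with u in H by vec end.
Qed.

Lemma rep_sublevel_closed n z k : is_dual k ->
  (forall eps, 0 < eps -> exists z' k' r, is_dual k' /\ h z' k' = Fin r /\ r <= n /\
     bnorm (bsub z' z) < eps /\ exists d, d < eps /\ dual_bound d (fun u => k' u - k u)) ->
  exists r, h z k = Fin r /\ r <= n.
Proof.
  intros Hk Happ. destruct h_rep as (_ & h_lsc & _ & _).
  apply NNPP. intros Hn.
  destruct (h_lsc z k n Hk) as (delta & Hd & H).
  - destruct (h z k) as [r|] eqn:Hr; [|exact I]. simpl.
    apply Rnot_le_lt. intros Hle. apply Hn. now exists r.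
  - destruct (Happ delta Hd) as (z' & k' & r & Hk' & Hr & Hrn & Hz & Hkd).
    specialize (H z' k' Hk' Hz Hkd). rewrite Hr in H. simpl in H. lra.
Qed.

(** Convex open mapping for [q (z, k, x) = z - A x - u] on triples from [Y], its dual and [X].
    Putting [h <= n] and the norm of the whole triple into [C n] is what bounds [h], [f] and [x] on
    the ball; norm lower semicontinuity closes [C n]. *)
Lemma constraint_ball u : ic Dh u ->
  exists M delta, 0 < delta /\ forall v, direction (aff Dh) u v -> bnorm v < delta ->
    exists z f r x, is_dual f /\ h z f = Fin r /\ r <= M /\ bnorm x <= M /\ dual_bound M f /\
      v = bsub z (badd (A x) u).
Proof.
  intros [Hcl Hicr]. pose proof (Dh_in u Hicr) as Hu.
  destruct (lin_bound A A_lin) as (N & HN0 & HN).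
  pose proof h_rep as (h_convex & _ & _ & _).
  assert (HuA : aff Dh u) by (now apply sub_aff).
  pose (C := fun n (w : prod_space (prod_space Y (dual_space Y)) X) =>
    (exists r, h (fst (fst w)) (proj1_sig (snd (fst w))) = Fin r /\ r <= INR n) /\ bnorm w <= INR n).
  pose (q := fun w : prod_space (prod_space Y (dual_space Y)) X =>
    bsub (fst (fst w)) (badd (A (snd w)) u)).
  destruct (convex_open_mapping C q (direction (aff Dh) u) (1 + N)) as (n & delta & Hd & Hball).
  - apply subspace_direction; [apply affine_aff|exact HuA].
  - now apply closed_direction.
  - intros n w [(r & Hr & Hrn) Hw]. unfold C; rewrite S_INR. split; [exists r; split; [exact Hr|lra]|lra].
  - intros n w w' t [(r & Hr & Hrn) Hw] [(r' & Hr' & Hrn') Hw'] Ht. split.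
    + destruct w as [[z k] x], w' as [[z' k'] x']. cbn [fst snd] in *.
      destruct (h_convex _ _ _ _ _ _ t (proj2_sig k) (proj2_sig k') Hr Hr' Ht) as (r2 & Hr2 & Hle).
      exists r2. split; [exact Hr2|nra].
    + apply Rle_trans with (1 := bnorm_triangle _ _ _). rewrite !bnorm_scal_pos by lra. nra.
  - intros n w Hlim. split.
    + apply rep_sublevel_closed; [apply proj2_sig|]. intros eps He.
      destruct (Hlim eps He) as (w' & [(r & Hr & Hrn) _] & Hw').
      destruct w as [[z k] x], w' as [[z' k'] x']. cbn [fst snd] in *.
      assert (Hsum : bnorm (bsub z' z) + bnorm (bsub (k' : dual_space Y) k) + bnorm (bsub x' x) < eps) by exact Hw'.
      pose proof (bnorm_ge0 (bsub z' z)). pose proof (bnorm_ge0 (bsub (k' : dual_space Y) k)).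
      pose proof (bnorm_ge0 (bsub x' x)).
      exists z', (proj1_sig k'), r.
      split; [apply proj2_sig|split; [exact Hr|split; [exact Hrn|split; [lra|]]]].
      exists (bnorm (bsub (k' : dual_space Y) k)). split; [lra|apply dual_space_sub_bound].
    + apply le_epsilon. intros e He. destruct (Hlim e He) as (w' & [_ Hw'] & Hd).
      pose proof (bnorm_le_sub w w'). rewrite bnorm_sub_sym in Hd. lra.
  - now intros n w [_ Hw].
  - intros w w' t. unfold q. destruct w as [[z k] x], w' as [[z' k'] x']. cbn [fst snd].
    transitivity (bsub (badd (bscal t z) (bscal (1 - t) z'))
      (badd (A (badd (bscal t x) (bscal (1 - t) x'))) u)); [reflexivity|].
    rewrite (lin_add A A_lin), !(lin_scal A A_lin). vec.
  - lra.
  - intros w w'. unfold q. destruct w as [[z k] x], w' as [[z' k'] x']. cbn [fst snd].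
    change (bnorm (bsub (bsub z (badd (A x) u)) (bsub z' (badd (A x') u))) <=
      (1 + N) * (bnorm (bsub z z') + bnorm (bsub (k : dual_space Y) k') + bnorm (bsub x x'))).
    replace (bsub (bsub z (badd (A x) u)) (bsub z' (badd (A x') u)))
      with (bsub (bsub z z') (A (bsub x x'))) by (rewrite (lin_sub A A_lin); vec).
    pose proof (bnorm_sub (bsub z z') (A (bsub x x'))). specialize (HN (bsub x x')).
    pose proof (bnorm_ge0 (bsub z z')). pose proof (bnorm_ge0 (bsub (k : dual_space Y) k')).
    pose proof (bnorm_ge0 (bsub x x')). nra.
  - intros n w [(r & Hr & _) _]. unfold q.
    replace (bsub (fst (fst w)) (badd (A (snd w)) u))
      with (bsub (bsub (fst (fst w)) (A (snd w))) u) by vec.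
    apply direction_sub, sub_aff. exists (fst (fst w)), (A (snd w)).
    split; [|split; [now exists (snd w)|easy]].
    apply prY_dom_iff. exists (proj1_sig (snd (fst w))), r. split; [apply proj2_sig|exact Hr].
  (* Absorption is what [icr] provides; any [n] above both the value of [h] and the norm of the
     triple will do. *)
  - intros v Hv.
    destruct (Hicr v) as (lam & Hlam & HD).
    { replace v with (bsub (badd u v) u) by vec. now apply aff_set_minus. }
    destruct (HD lam ltac:(lra)) as (z & ? & Hz & [x ->] & Heq).
    apply prY_dom_iff in Hz. destruct Hz as (k & r & Hk & Hr).
    set (w := ((z, dual_mk k Hk), x) : prod_space (prod_space Y (dual_space Y)) X).
    destruct (INR_unbounded (Rmax r (bnorm w))) as [n Hn].
    pose proof (Rmax_l r (bnorm w)). pose proof (Rmax_r r (bnorm w)).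
    exists lam, n, w. split; [exact Hlam|split].
    + split; [|lra]. exists r. split; [exact Hr|lra].
    + unfold q, w. cbn [fst snd].
      replace (bsub z (badd (A x) u)) with (bsub (bsub z (A x)) u) by vec.
      rewrite <- Heq. vec.
  - exists (INR n), delta. split; [exact Hd|]. intros v Hv Hvd.
    destruct (Hball v Hv Hvd) as ([[z k] x] & [(r & Hr & Hrn) Hw] & Hq).
    assert (Hsum : bnorm z + bnorm (k : dual_space Y) + bnorm x <= INR n) by exact Hw.
    pose proof (bnorm_ge0 z). pose proof (bnorm_ge0 (k : dual_space Y)). pose proof (bnorm_ge0 x).
    exists z, (proj1_sig k), r, x.
    split; [apply proj2_sig|split; [exact Hr|split; [exact Hrn|split; [lra|split; [|now symmetry]]]]].
    apply dual_bound_le with (2 := dual_norm_bound k). simpl in *. lra.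
Qed.

Lemma dom_h_direction u z f r x : aff Dh u -> is_dual f -> h z f = Fin r ->
  direction (aff Dh) u (bsub z (badd (A x) u)).
Proof.
  intros Hu Hf Hr.
  replace (bsub z (badd (A x) u)) with (bsub (bsub z (A x)) u) by vec.
  apply direction_sub, sub_aff. exists z, (A x). split; [|split; [now exists x|easy]].
  apply prY_dom_iff. now exists f, r.
Qed.

(* Near [u] the shifted maps [x |-> A x + v] satisfy the same constraint qualification, and
   [precomp_nonempty] for each of them says [v] lies in [DT]. *)
Lemma ic_ball_DT u : ic Dh u ->
  exists delta, 0 < delta /\ forall v, aff Dh v -> bnorm (bsub v u) < delta -> DT v.
Proof.
  intros Hic. destruct (constraint_ball u Hic) as (M & delta & Hd & Hball).
  destruct Hic as [_ Hicr]. pose proof (sub_aff _ _ (Dh_in u Hicr)) as Hu.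
  destruct h_rep as (h_convex & _ & _ & h_T).
  exists (delta / 2). split; [lra|]. intros v Hv Hvu.
  pose proof (subspace_direction _ u (affine_aff Dh) Hu) as HW.
  (* The centre has moved by less than [delta / 2], so half of the radius remains for the shifted
     map. *)
  destruct (precomp_nonempty T h A v (direction (aff Dh) v) M (delta / 2)) as (x & s & f & Hf & _); auto.
  - exact rep_ge.
  - now apply subspace_direction; [apply affine_aff|].
  - intros. now apply dom_h_direction with f r.
  - lra.
  - intros w Hw Hwd.
    assert (Hw' : direction (aff Dh) u (badd (bsub v u) w)).
    { unfold direction. now replace (badd u (badd (bsub v u) w)) with (badd v w) by vec. }
    destruct (Hball _ Hw') as (z & f & r & x & Hf & Hr & HrM & Hx & HfM & Heq).
    + pose proof (bnorm_triangle _ (bsub v u) w). lra.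
    + exists z, f, r, x. repeat (split; [assumption|]).
      replace w with (bsub (badd (bsub v u) w) (bsub v u)) by vec. rewrite Heq. vec.
  - exists (badd (A x) v), (A x). split; [now exists f|split; [now exists x|vec]].
Qed.

(** A cycle through [ic D], [ic Dh], [ri D] and back: the first step rests on the hull of [D]
    containing [Dh], the second on a relative ball already inside the smallest set [DT]. *)
Lemma ic_iff (D : set Y) u : (forall y, DT y -> D y) -> (forall y, D y -> Dh y) ->
  (ic D u <-> ic Dh u) /\ (ri D u <-> ic Dh u).
Proof.
  intros HTD HDh.
  assert (Hup : ic D u -> ic Dh u).
  { intros H. apply ic_mono with (3 := H); [exact HDh|]. apply dom_h_in_hull; [exact HTD|apply H]. }
  assert (Hdown : ic Dh u -> ri D u).
  { intros Hic. destruct (ic_ball_DT u Hic) as (delta & Hd & Hball).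
    destruct Hic as [Hcl Hicr]. pose proof (sub_aff _ _ (Dh_in u Hicr)) as Hu.
    assert (HDu : DT u).
    { apply Hball; [exact Hu|]. replace (bsub u u) with (@bzero Y) by vec. now rewrite bnorm_0. }
    (* The ball spans the hull: [y] is extrapolated, with factor [c], from [u] and a point towards
       [y] at distance less than [delta]. *)
    assert (Haff : forall y, aff Dh y -> aff D y).
    { intros y Hy. set (c := 2 * (bnorm (bsub y u) + 1) / delta).
      pose proof (bnorm_ge0 (bsub y u)) as Hn.
      assert (Hc : 0 < c) by (apply Rdiv_lt_0_compat; lra).
      replace y with (badd (bscal c (badd u (bscal (/ c) (bsub y u)))) (bscal (1 - c) u)) by vecf.
      apply affine_aff; [|now apply sub_aff, HTD].
      apply sub_aff, HTD, Hball.
      - apply (subspace_direction _ u (affine_aff Dh) Hu). now apply direction_sub.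
      - replace (bsub (badd u (bscal (/ c) (bsub y u))) u) with (bscal (/ c) (bsub y u)) by vec.
        rewrite bnorm_scal_pos by (left; now apply Rinv_0_lt_compat).
        apply Rmult_lt_reg_l with c; [exact Hc|]. rewrite <- Rmult_assoc, Rinv_r by lra.
        replace (c * delta) with (2 * (bnorm (bsub y u) + 1)) by (unfold c; field; lra). lra. }
    assert (HaffDh : forall y, aff D y -> aff Dh y) by (now apply aff_mono).
    split; [|split; [now apply HTD|]].
    - apply closed_set_iff with (2 := Hcl). intros y; split; [apply Haff|apply HaffDh].
    - exists delta. split; [exact Hd|]. intros v Hv Hvu. apply HTD, Hball; [now apply HaffDh|exact Hvu]. }
  split; split; auto using ri_ic.
Qed.

Lemma adj_comp_typeD : ic Dh bzero -> gossez_typeD (adj_comp A T).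
Proof.
  intros Hic. destruct (constraint_ball bzero Hic) as (M & delta & Hd & Hball).
  destruct Hic as [_ Hicr]. pose proof (sub_aff _ _ (Dh_in bzero Hicr)) as Hu.
  destruct h_rep as (h_convex & _ & _ & h_T).
  replace (adj_comp A T) with (precomp T A bzero).
  - apply (precomp_typeD T h A bzero (direction (aff Dh) bzero) M delta); auto.
    + exact rep_ge.
    + now apply subspace_direction; [apply affine_aff|].
    + intros. now apply dom_h_direction with f r.
  - apply functional_extensionality; intros x. unfold precomp, adj_comp. now rewrite badd_0.
Qed.

End Domains.

Theorem theorem4p7 (X Y : BanachSpace) (T : Op Y) (h : EFun Y) (A : X -> Y) :
  nonzero_space X -> nonzero_space Y ->
  gossez_typeD T ->
  representative h T -> strong_rep h ->
  lin_cont A ->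
  (exists y, prY_dom h y /\ image A y) ->
  let S1 := set_minus (dom_op T) (image A) in
  let S2 := set_minus (co (dom_op T)) (image A) in
  let S3 := set_minus (prY_dom h) (image A) in
  (* (a) *)
  (forall u,
     (ic S1 u <-> ri S1 u) /\ (ri S1 u <-> ic S2 u) /\ (ic S2 u <-> ri S2 u) /\
     (ri S2 u <-> ic S3 u) /\ (ic S3 u <-> ri S3 u)) /\
  (* (b) *)
  ((ic S1 bzero <-> ri S1 bzero) /\ (ri S1 bzero <-> ic S2 bzero) /\
   (ic S2 bzero <-> ri S2 bzero) /\ (ri S2 bzero <-> ic S3 bzero) /\
   (ic S3 bzero <-> ri S3 bzero)) /\
  (ic S1 bzero -> gossez_typeD (adj_comp A T)) /\
  (ri S1 bzero -> gossez_typeD (adj_comp A T)) /\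
  (ic S2 bzero -> gossez_typeD (adj_comp A T)) /\
  (ri S2 bzero -> gossez_typeD (adj_comp A T)) /\
  (ic S3 bzero -> gossez_typeD (adj_comp A T)) /\
  (ri S3 bzero -> gossez_typeD (adj_comp A T)).
Proof.
  intros _ _ [HT _] Hrep Hstrong HA _ S1 S2 S3.
  assert (H12 : forall y, S1 y -> S2 y).
  { intros y (z & w & Hz & Hw & ->). exists z, w. split; [|now split].
    intros C _ HC. now apply HC. }
  assert (H23 : forall y, S2 y -> S3 y).
  { intros y (z & w & Hz & Hw & ->). exists z, w. split; [|now split].
    now apply (co_dom_op_prY T h HT Hrep). }
  assert (H1 : forall u, (ic S1 u <-> ic S3 u) /\ (ri S1 u <-> ic S3 u)).
  { intros u. apply (ic_iff T h A HT Hrep Hstrong HA); intros y Hy; [exact Hy|exact (H23 y (H12 y Hy))]. }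
  assert (H2 : forall u, (ic S2 u <-> ic S3 u) /\ (ri S2 u <-> ic S3 u)).
  { intros u. apply (ic_iff T h A HT Hrep Hstrong HA); intros y Hy; [exact (H12 y Hy)|exact (H23 y Hy)]. }
  assert (H3 : forall u, (ic S3 u <-> ic S3 u) /\ (ri S3 u <-> ic S3 u)).
  { intros u. apply (ic_iff T h A HT Hrep Hstrong HA); intros y Hy; [exact (H23 y (H12 y Hy))|exact Hy]. }
  pose proof (adj_comp_typeD T h A HT Hrep Hstrong HA : ic S3 bzero -> _) as HD.
  assert (Ha : forall u,
     (ic S1 u <-> ri S1 u) /\ (ri S1 u <-> ic S2 u) /\ (ic S2 u <-> ri S2 u) /\
     (ri S2 u <-> ic S3 u) /\ (ic S3 u <-> ri S3 u)).
  { intros u. specialize (H1 u). specialize (H2 u). specialize (H3 u). tauto. }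
  specialize (H1 bzero). specialize (H2 bzero). specialize (H3 bzero).
  split; [exact Ha|split; [apply Ha|]]. tauto.
Qed.
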